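(* Assume the Exponential Time Hypothesis (ETH). Then: (i) there is no algorithm that solves \textsc{Locating-Dominating Set} in time $2^{2^{o(\mathrm{tw})}} \cdot n^{\mathcal{O}(1)}$, where $n$ is the number of vertices of the input graph $G$ and $\mathrm{tw}$ is the treewidth of $G$; (ii) there is no algorithm that solves \textsc{Test Cover} in time $2^{2^{o(\mathrm{tw})}} \cdot (|U|+|\mathcal{F}|)^{\mathcal{O}(1)}$, where $\mathrm{tw}$ is the treewidth of the auxiliary graph of the input instance $(U,\mathcal{F},k)$.
   Context: Graphs are finite, simple, undirected. For a graph $G$ and vertex $v$, $N(v)$ is the set of neighbours of $v$. A set $S\subseteq V(G)$ is a locating-dominating set if every vertex of $V(G)\setminus S$ has a neighbour in $S$, and for any two distinct $u,v\in V(G)\setminus S$ we have $N(u)\cap S\neq N(v)\cap S$. \textsc{Locating-Dominating Set}: given a graph $G$ on $n$ vertices and an integer $k$, decide whether $G$ has a locating-dominating set of size at most $k$. \textsc{Test Cover}: given a finite set $U$ of items, a collection $\mathcal{F}$ of subsets of $U$ (tests), and an integer $k$, decide whether there is a subcollection of at most $k$ tests such that for every pair of distinct items some chosen test contains exactly one of the two items. The auxiliary graph of $(U,\mathcal{F},k)$ is the bipartite graph with one vertex for each test and one vertex for each item, where a test-vertex is adjacent to an item-vertex iff the test contains the item. ETH: there is no algorithm solving $3$-SAT on $n$ variables in time $2^{o(n)} n^{\mathcal{O}(1)}$. *)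

(* Defs.v *)
From mathcomp Require Import all_boot.

Set Implicit Arguments.
Unset Strict Implicit.
Unset Printing Implicit Defensive.

(* Machine model: deterministic single-tape Turing machines over the   *)
(* tape alphabet {0,1,blank} (blank = None), with finitely many states *)
(* 'I_(Q+1), start state ord0, and distinct accept / reject states.    *)

Variant move := MLeft | MRight | MStay.
Definition sym := option bool.

Record TM := MkTM {
  tm_Q : nat;
  tm_delta : 'I_tm_Q.+1 -> sym -> 'I_tm_Q.+1 * sym * move;
  tm_acc : 'I_tm_Q.+1;
  tm_rej : 'I_tm_Q.+1 }.

(* left part of the tape is stored reversed (nearest cell first). *)
Record config (M : TM) := Config {
  c_state : 'I_(tm_Q M).+1;
  c_left : seq sym;
  c_head : sym;
  c_right : seq sym }.

Definition halted (M : TM) (c : config M) : bool :=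
  (c_state c == tm_acc M) || (c_state c == tm_rej M).

Definition step (M : TM) (c : config M) : config M :=
  if halted c then c else
  let: (q', w, mv) := tm_delta (c_state c) (c_head c) in
  match mv with
  | MStay => Config q' (c_left c) w (c_right c)
  | MLeft =>
      match c_left c with
      | [::] => Config q' [::] None (w :: c_right c)
      | a :: l => Config q' l a (w :: c_right c)
      end
  | MRight =>
      match c_right c with
      | [::] => Config q' (w :: c_left c) None [::]
      | a :: r => Config q' (w :: c_left c) a r
      end
  end.

Definition init (M : TM) (x : seq bool) : config M :=
  Config (ord0 : 'I_(tm_Q M).+1) [::] (head None (map Some x)) (behead (map Some x)).

Definition run (M : TM) (t : nat) (x : seq bool) : config M :=
  iter t (@step M) (init M x).

Definition solves_within (A : Type) (M : TM) (valid P : A -> Prop)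
    (enc : A -> seq bool) (B : A -> nat -> Prop) : Prop :=
  tm_acc M != tm_rej M /\
  forall a, valid a -> exists t, B a t /\
    ((c_state (run M t (enc a)) = tm_acc M /\ P a) \/
     (c_state (run M t (enc a)) = tm_rej M /\ ~ P a)).

Definition little_o (g : nat -> nat) : Prop :=
  forall e, 0 < e -> exists N, forall t, N <= t -> e * g t <= t.

Definition unary (n : nat) : seq bool := nseq n true ++ [:: false].

Record cnf3 := Cnf3 {
  nvars : nat;
  clauses : seq (('I_nvars * bool) * ('I_nvars * bool) * ('I_nvars * bool)) }.

Definition lit_true (n : nat) (f : 'I_n -> bool) (l : 'I_n * bool) : bool :=
  f l.1 == l.2.

Definition satisfiable3 (phi : cnf3) : Prop :=
  exists f : 'I_(nvars phi) -> bool,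
    all (fun c => [|| lit_true f c.1.1, lit_true f c.1.2 | lit_true f c.2])
        (clauses phi).

Definition enc_lit (n : nat) (l : 'I_n * bool) : seq bool := l.2 :: unary l.1.

Definition enc_cnf3 (phi : cnf3) : seq bool :=
  unary (nvars phi) ++
  flatten [seq enc_lit c.1.1 ++ enc_lit c.1.2 ++ enc_lit c.2 | c <- clauses phi].

Definition ETH : Prop :=
  ~ exists (M : TM) (C c : nat) (g : nat -> nat),
      little_o g /\
      solves_within M (fun _ => True) satisfiable3 enc_cnf3
        (fun phi t => t <= C * 2 ^ (g (nvars phi)) * (size (enc_cnf3 phi)).+1 ^ c).

Record graph := Graph { gn : nat; gadj : 'I_gn -> 'I_gn -> bool }.

Definition simple_graph (G : graph) : Prop :=
  symmetric (@gadj G) /\ irreflexive (@gadj G).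

Definition is_tree (m : nat) (T : 'I_m.+1 -> 'I_m.+1 -> bool) : Prop :=
  symmetric T /\ irreflexive T /\
  (forall x y, connect [rel a b | T a b] x y) /\
  #|[set p : 'I_m.+1 * 'I_m.+1 | T p.1 p.2]| = 2 * m.

Definition tw_le (G : graph) (w : nat) : Prop :=
  exists (m : nat) (T : 'I_m.+1 -> 'I_m.+1 -> bool)
         (bag : 'I_m.+1 -> {set 'I_(gn G)}),
    [/\ is_tree T,
        forall v, exists x, v \in bag x,
        forall u v, @gadj G u v -> exists x, (u \in bag x) && (v \in bag x),
        forall v x y, v \in bag x -> v \in bag y ->
          connect [rel a b | [&& T a b, v \in bag a & v \in bag b]] x y
      & forall x, #|bag x| <= w.+1].

Definition is_treewidth (G : graph) (t : nat) : Prop :=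
  tw_le G t /\ forall w, tw_le G w -> t <= w.

Definition locating_dominating (G : graph) (S : {set 'I_(gn G)}) : Prop :=
  (forall v, v \notin S -> exists2 u, u \in S & @gadj G v u) /\
  (forall u v, u \notin S -> v \notin S -> u != v ->
     [set w in S | @gadj G u w] != [set w in S | @gadj G v w]).

Record lds_inst := LdsInst { lds_G : graph; lds_k : nat }.

Definition lds_yes (I : lds_inst) : Prop :=
  exists S : {set 'I_(gn (lds_G I))}, #|S| <= lds_k I /\ locating_dominating S.

Definition enc_graph (G : graph) : seq bool :=
  unary (gn G) ++ [seq @gadj G i j | i <- enum 'I_(gn G), j <- enum 'I_(gn G)].

Definition enc_lds (I : lds_inst) : seq bool :=
  enc_graph (lds_G I) ++ nseq (lds_k I) true.

(* items 'I_nU, tests 'I_nF, tc_mem t u = "test t contains item u" *)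
Record tc_inst := TcInst {
  tc_nU : nat; tc_nF : nat; tc_mem : 'I_tc_nF -> 'I_tc_nU -> bool; tc_k : nat }.

Definition tc_yes (I : tc_inst) : Prop :=
  exists S : {set 'I_(tc_nF I)}, #|S| <= tc_k I /\
    forall u v : 'I_(tc_nU I), u != v ->
      exists2 t, t \in S & @tc_mem I t u != tc_mem t v.

Definition tc_aux (I : tc_inst) : graph :=
  Graph (fun x y : 'I_(tc_nF I + tc_nU I) =>
    match split x, split y with
    | inl t, inr u => @tc_mem I t u
    | inr u, inl t => @tc_mem I t u
    | _, _ => false
    end).

Definition enc_tc (I : tc_inst) : seq bool :=
  unary (tc_nU I) ++ unary (tc_nF I) ++
  [seq @tc_mem I t u | t <- enum 'I_(tc_nF I), u <- enum 'I_(tc_nU I)] ++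
  nseq (tc_k I) true.

(* Main.v *)
(* A formula with n variables is turned into a graph of treewidth O(log n) and
   size polynomial in n; since 2^o(log n) = o(n), an algorithm running in time
   2^(2^o(tw)) N^O(1) would decide 3-SAT in subexponential time.

   The graph consists of a forest of small variable and clause gadgets together
   with O(log n) hubs, adjacent to a vertex according to the binary code of that
   vertex.  The hubs distinguish any two vertices with different codes.  The
   s-th literal of a clause is represented by two vertices with the same code,
   one attached to the vertex of the literal in its variable gadget, the other
   to a selector in the clause gadget.  The budget lets a solution contain one
   literal of each variable and two of the three selectors of each clause, so
   that for each clause some pair has to be separated by a true literal.  The
   gadgets are indexed by all (2n)^3 possible clauses, so that repeated clauses
   do not increase the treewidth; for an absent clause, the two vertices of each
   pair simply get different codes.

   The reduction is carried out on Turing machines: programs on several stacks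
   are simulated on a single tape, and functions are shown to be computable in
   polynomial time by closure under arithmetic, bounded sums and iterated
   subtraction, with numbers held in unary on the stacks. *)

From Stdlib Require Import ZArith FunctionalExtensionality Classical.
Require Import Defs.
From mathcomp Require Import all_boot zify.

Set Implicit Arguments.
Unset Strict Implicit.
Unset Printing Implicit Defensive.

(** * Turing machine fragments *)

(** Direct edges from clause gadgets to variables would create cycles and a large treewidth. The
    incidence is cut inside each pair instead: one vertex is a leaf at a literal, the other a leaf
    at a selector, and only their equal codes tie the clause to the variable. Deleting the hubs
    leaves a forest. The number of vertices is O(n^3), hence 2^tw <= (16 n)^3, and 6 g(tw) <= tw
    gives 2^g(tw) = O(sqrt n), which is o(n). Both problems share the gadgets and differ in how the
    hubs are paid for: by two pendants at each hub for locating-dominating sets, by an item lying in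
    no test for test covers. On the machine side, unary numbers are affordable because every
    intermediate value is polynomial in the input. *)

Record tape := Tape { pos : Z; cell : Z -> sym }.

Definition dir (mv : move) : Z :=
  match mv with MLeft => -1 | MRight => 1 | MStay => 0 end.

Definition upd_cell (c : Z -> sym) (p : Z) (w : sym) : Z -> sym :=
  fun z => if Z.eqb z p then w else c z.

Definition act (T : tape) (w : sym) (mv : move) : tape :=
  Tape (pos T + dir mv) (upd_cell (cell T) (pos T) w).

Lemma upd_cell_id c p : upd_cell c p (c p) = c.
Proof. by apply: functional_extensionality => z; rewrite /upd_cell; case: Z.eqb_spec => // ->. Qed.

(** A fragment never halts: it leaves through an exit labelled in [E]. The label passes what was
    found, such as a popped symbol, to the code that follows. *)
Record pm (E : Type) := PM {
  pm_st : finType;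
  pm_s0 : pm_st;
  pm_d : pm_st -> sym -> sym * move * (pm_st + E) }.

Inductive runs_from (E : Type) (p : pm E) : pm_st p -> tape -> nat -> E -> tape -> Prop :=
| RunsExit s T w mv e :
    pm_d s (cell T (pos T)) = (w, mv, inr e) -> runs_from s T 1 e (act T w mv)
| RunsStep s T w mv s' t e T' :
    pm_d s (cell T (pos T)) = (w, mv, inl s') ->
    runs_from s' (act T w mv) t e T' -> runs_from s T t.+1 e T'.

Definition runs E (p : pm E) T t e T' := runs_from (pm_s0 p) T t e T'.

Definition prim E (f : sym -> sym * move * E) : pm E :=
  @PM E unit tt (fun _ a => ((f a).1, inr (f a).2)).

Definition ret E (e : E) : pm E := prim (fun a => (a, MStay, e)).

Lemma runs_prim E (f : sym -> sym * move * E) T w mv e :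
  f (cell T (pos T)) = (w, mv, e) -> runs (prim f) T 1 e (act T w mv).
Proof. by move=> H; apply: RunsExit; rewrite /= H. Qed.

Lemma runs_ret E (e : E) T : runs (ret e) T 1 e T.
Proof.
have E1 : act T (cell T (pos T)) MStay = T.
  by case: T => p c; rewrite /act /= upd_cell_id Z.add_0_r.
by rewrite -{2}E1; apply: runs_prim.
Qed.

Section Bind.
Variables (E : finType) (F : Type) (p : pm E) (q : E -> pm F).

(** Control enters [q e] in the very transition that leaves [p], so running times add up exactly.
    The state space is a sum over all labels [e], which is why they form a finite type. *)
Definition bind : pm F :=
  @PM F (pm_st p + {e : E & pm_st (q e)})%type (inl (pm_s0 p))
    (fun s a => match s with
     | inl s => let: (wm, r) := pm_d s a in
        (wm, inl (match r with inl s' => inl s'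
                  | inr e => inr (Tagged (fun e => pm_st (q e)) (pm_s0 (q e))) end))
     | inr (existT e s) => let: (wm, r) := pm_d s a in
        (wm, match r with inl s' => inl (inr (Tagged (fun e => pm_st (q e)) s'))
             | inr f => inr f end)
     end).

Lemma runs_bind T t1 e T1 t2 f T2 :
  runs p T t1 e T1 -> runs (q e) T1 t2 f T2 -> runs bind T (t1 + t2) f T2.
Proof.
rewrite /runs /=; move=> H1 H2.
have {}H2 : @runs_from F bind (inr (Tagged (fun e => pm_st (q e)) (pm_s0 (q e)))) T1 t2 f T2.
  elim: H2 => [s T0 w mv f0 H|s T0 w mv s' t f0 T' H _ IH].
    by apply: RunsExit; rewrite /= H.
  by apply: (@RunsStep F bind _ _ w mv (inr (Tagged (fun e => pm_st (q e)) s')) _ _ _ _ IH); rewrite /= H.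
elim: H1 H2 => [s T0 w mv e0 H|s T0 w mv s' t e0 T' H _ IH] H2.
  by rewrite add1n; apply: (@RunsStep F bind _ _ w mv _ _ _ _ _ H2); rewrite /= H.
by rewrite addSn; apply: (@RunsStep F bind _ _ w mv (inl s') _ _ _ _ (IH H2)); rewrite /= H.
Qed.
End Bind.

Section LoopPM.
Variables (F : Type) (p : pm (option F)).

Definition loop : pm F :=
  @PM F (pm_st p) (pm_s0 p)
    (fun s a => let: (wm, r) := pm_d s a in
       (wm, match r with inl s' => inl s' | inr None => inl (pm_s0 p)
            | inr (Some f) => inr f end)).

Lemma runs_loop_exit T t f T1 : runs p T t (Some f) T1 -> runs loop T t f T1.
Proof.
rewrite /runs /=; move: (pm_s0 p); move Eo: (Some f) => o s H; move: Eo.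
elim: H => [s' T0 w mv e H|s' T0 w mv s'' t' e T' H _ IH] Eo.
  by apply: RunsExit; rewrite /= H -Eo.
by apply: (@RunsStep F loop _ _ w mv s'' _ _ _ _ (IH Eo)); rewrite /= H.
Qed.

Lemma runs_loop_step T t T1 t2 f T2 :
  runs p T t None T1 -> runs loop T1 t2 f T2 -> runs loop T (t + t2) f T2.
Proof.
rewrite /runs /=; move: {1 3}(pm_s0 p); move Eo: None => o s H H2; move: Eo H2.
elim: H => [s' T0 w mv e H|s' T0 w mv s'' t' e T' H _ IH] Eo H2.
  by rewrite add1n; apply: (@RunsStep F loop _ _ w mv (pm_s0 p) _ _ _ _ H2); rewrite /= H -Eo.
by rewrite addSn; apply: (@RunsStep F loop _ _ w mv s'' _ _ _ _ (IH Eo H2)); rewrite /= H.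
Qed.
End LoopPM.

Fixpoint moves (n : nat) (mv : move) : pm unit :=
  if n is n'.+1 then bind (prim (fun a => (a, mv, tt))) (fun _ => moves n' mv)
  else ret tt.

Lemma runs_moves n mv p c :
  runs (moves n mv) (Tape p c) n.+1 tt (Tape (p + Z.of_nat n * dir mv) c).
Proof.
elim: n p => [|n IH] p /=.
  by have := runs_ret tt (Tape p c); rewrite Z.add_0_r.
rewrite -[n.+2]add1n.
apply: runs_bind; first exact: runs_prim.
rewrite /act /= upd_cell_id.
have -> : (p + Z.of_nat n.+1 * dir mv = p + dir mv + Z.of_nat n * dir mv)%Z by lia.
exact: IH.
Qed.

Definition scan (n : nat) (mv : move) : pm unit :=
  loop (bind (prim (fun a => (a, MStay, isSome a)))
    (fun b : bool => if b then bind (moves n mv) (fun _ => ret None) else ret (Some tt))).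

Lemma runs_scan n mv p (c : Z -> sym) m :
  (forall k, k < m -> isSome (c (p + Z.of_nat (k * n) * dir mv)%Z)) ->
  c (p + Z.of_nat (m * n) * dir mv)%Z = None ->
  runs (scan n mv) (Tape p c) (m * (n + 3) + 2) tt (Tape (p + Z.of_nat (m * n) * dir mv) c).
Proof.
elim: m p => [|m IH] p Hs Hn.
  move: Hn; rewrite mul0n Z.add_0_r => Hn.
  apply: runs_loop_exit; rewrite mul0n -[0 + 2]/(1 + 1).
  apply: runs_bind; first exact: runs_prim.
  rewrite /= Hn /act /=.
  have -> : upd_cell c p None = c by rewrite -{1}Hn upd_cell_id.
  by rewrite Z.add_0_r; apply: runs_ret.
have -> : m.+1 * (n + 3) + 2 = (1 + (n.+1 + 1)) + (m * (n + 3) + 2) by lia.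
apply: (@runs_loop_step _ _ _ _ (Tape (p + Z.of_nat n * dir mv) c)).
  apply: runs_bind; first exact: runs_prim.
  rewrite /act /= upd_cell_id Z.add_0_r.
  have := Hs 0 isT; rewrite mul0n Z.add_0_r => ->.
  apply: runs_bind; first exact: runs_moves.
  exact: runs_ret.
have E0 k : (p + Z.of_nat (k.+1 * n) * dir mv = p + Z.of_nat n * dir mv + Z.of_nat (k * n) * dir mv)%Z
  by lia.
rewrite E0; apply: IH; last by rewrite -E0.
by move=> k lt_k; rewrite -E0; apply: Hs.
Qed.

(** * Stacks on a tape *)

Definition stacks := nat -> seq bool.

Definition upd (s : stacks) (i : nat) (w : seq bool) : stacks :=
  fun j => if j == i then w else s j.

(* Stack 0 occupies the right half-tape contiguously, bottom first; stacks 1..K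
   are interleaved on the left half-tape.  The K blanks at -K..-1 and the one
   at 0 give every stack a blank cell below its bottom, at height -1. *)
Definition fw (i : nat) : move := if i == 0 then MRight else MLeft.
Definition bk (i : nat) : move := if i == 0 then MLeft else MRight.
Definition stride (K i : nat) : nat := if i == 0 then 1 else K.
Definition off (K i : nat) : nat := if i == 0 then 1 else K + i.

Definition addr (K i : nat) (j : Z) : Z :=
  ((Z.of_nat (off K i) + Z.of_nat (stride K i) * j) * dir (fw i))%Z.

Definition tape_of (K : nat) (s : stacks) (c : Z -> sym) : Prop :=
  (forall i j, i <= K -> c (addr K i (Z.of_nat j)) = nth None (map Some (rev (s i))) j) /\
  (forall z, (- Z.of_nat K <= z <= 0)%Z -> c z = None).

Lemma dir_bk i : dir (bk i) = (- dir (fw i))%Z.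
Proof. by rewrite /bk /fw; case: eqP. Qed.

Lemma addr_main K j : addr K 0 j = (1 + j)%Z.
Proof. by rewrite /addr /off /stride /fw eqxx /dir; lia. Qed.

Lemma addr_side K i j : 0 < i ->
  addr K i j = (- (Z.of_nat K + Z.of_nat i + Z.of_nat K * j))%Z.
Proof. by rewrite /addr /off /stride /fw; case: i => // i _; rewrite /dir eqn0Ngt /=; lia. Qed.

Lemma addr_inj K i i' j j' : i <= K -> i' <= K ->
  addr K i (Z.of_nat j) = addr K i' (Z.of_nat j') -> i = i' /\ j = j'.
Proof.
case: (posnP i) => [->|Hi]; case: (posnP i') => [->|Hi'] HK HK';
  rewrite ?addr_main ?(addr_side _ _ Hi) ?(addr_side _ _ Hi').
- by lia.
- by nia.
- by nia.
move=> H.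
(* Dividing by [K] recovers the height, since [i - 1] is a remainder below [K]. *)
have E0 : K * j + (i - 1) = K * j' + (i' - 1) by nia.
have Kp : 0 < K by lia.
have := congr1 (divn^~ K) E0; rewrite ![K * _]mulnC !divnMDl // !divn_small ?addn0; lia.
Qed.

Lemma addr_below K i : i <= K -> (- Z.of_nat K <= addr K i (-1) <= 0)%Z.
Proof.
by case: (posnP i) => [->|Hi] HK; rewrite ?addr_main ?(addr_side _ _ Hi); lia.
Qed.

Lemma addr_outside K i j : i <= K ->
  ~ (- Z.of_nat K <= addr K i (Z.of_nat j) <= 0)%Z.
Proof.
by case: (posnP i) => [->|Hi] HK; rewrite ?addr_main ?(addr_side _ _ Hi); nia.
Qed.

Lemma tape_of_below K s c i : i <= K -> tape_of K s c -> c (addr K i (-1)) = None.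
Proof. by move=> iK [_ H]; apply: H; apply: addr_below. Qed.

Lemma tape_of_push K s c i b : i <= K -> tape_of K s c ->
  tape_of K (upd s i (b :: s i)) (upd_cell c (addr K i (Z.of_nat (size (s i)))) (Some b)).
Proof.
move=> iK [H1 H2]; split=> [i' j i'K|z Hz]; rewrite /upd_cell /upd; last first.
  by case: Z.eqb_spec => [E|_]; [case: (@addr_outside K i (size (s i)) iK); rewrite -E | apply: H2].
case: Z.eqb_spec => [E|NE].
  have [-> ->] := addr_inj i'K iK E; rewrite eqxx rev_cons map_rcons nth_rcons.
  by rewrite size_map size_rev ltnn eqxx.
rewrite H1 //; case: (i' =P i) => [Ei|//]; subst i'.
rewrite rev_cons map_rcons nth_rcons size_map size_rev.
case: ltngtP => [//|lt|E]; last by case: NE; rewrite E.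
by rewrite nth_default // size_map size_rev ltnW.
Qed.

Lemma tape_of_pop K s c i b w : i <= K -> tape_of K s c -> s i = b :: w ->
  tape_of K (upd s i w) (upd_cell c (addr K i (Z.of_nat (size w))) None).
Proof.
move=> iK [H1 H2] Es; split=> [i' j i'K|z Hz]; rewrite /upd_cell /upd; last first.
  by case: Z.eqb_spec => [//|_]; apply: H2.
case: Z.eqb_spec => [E|NE].
  have [-> ->] := addr_inj i'K iK E; rewrite eqxx nth_default //.
  by rewrite size_map size_rev.
rewrite H1 //; case: (i' =P i) => [Ei|//]; subst i'.
rewrite Es rev_cons map_rcons nth_rcons size_map size_rev.
case: ltngtP => [//|lt|E]; last by case: NE; rewrite E.
by rewrite nth_default // size_map size_rev ltnW.
Qed.

(** Between operations the head rests at cell 0. It finds its way back by scanning down to the blank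
    at height -1, whose distance to cell 0 is [off K i - stride K i]. *)
Definition push (K i : nat) (b : bool) : pm unit :=
  bind (moves (off K i) (fw i)) (fun _ =>
  bind (scan (stride K i) (fw i)) (fun _ =>
  bind (prim (fun _ => (Some b, MStay, tt))) (fun _ =>
  bind (scan (stride K i) (bk i)) (fun _ =>
  moves (off K i - stride K i) (bk i))))).

(** On an empty stack the cell read is the blank at height -1 itself: erasing it changes nothing,
    and no scan back is needed. *)
Definition pop (K i : nat) : pm sym :=
  bind (moves (off K i) (fw i)) (fun _ =>
  bind (scan (stride K i) (fw i)) (fun _ =>
  bind (moves (stride K i) (bk i)) (fun _ =>
  bind (prim (fun a => (None, MStay, a))) (fun a : sym =>
  bind (if a is None then ret tt else
        bind (moves (stride K i) (bk i)) (fun _ => scan (stride K i) (bk i))) (fun _ =>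
  bind (moves (off K i - stride K i) (bk i)) (fun _ => ret a)))))).

Lemma scan_up K s c i : i <= K -> tape_of K s c ->
  runs (scan (stride K i) (fw i)) (Tape (addr K i 0) c) (size (s i) * (stride K i + 3) + 2) tt
    (Tape (addr K i (Z.of_nat (size (s i)))) c).
Proof.
move=> iK [H1 H2].
have E k : (addr K i 0 + Z.of_nat (k * stride K i) * dir (fw i))%Z = addr K i (Z.of_nat k)
  by rewrite /addr; lia.
rewrite -E; apply: runs_scan => [k lt_k|]; rewrite E H1 //.
  by rewrite (nth_map false) // size_rev.
by rewrite nth_default // size_map size_rev.
Qed.

Lemma scan_down K s c i m : i <= K -> tape_of K s c -> m <= size (s i) ->
  runs (scan (stride K i) (bk i)) (Tape (addr K i (Z.of_nat m - 1)) c) (m * (stride K i + 3) + 2) tt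
    (Tape (addr K i (-1)) c).
Proof.
move=> iK Hc lem.
have E k : (addr K i (Z.of_nat m - 1) + Z.of_nat (k * stride K i) * dir (bk i))%Z
     = addr K i (Z.of_nat m - 1 - Z.of_nat k) by rewrite /addr dir_bk; lia.
have -> : addr K i (-1) = (addr K i (Z.of_nat m - 1) + Z.of_nat (m * stride K i) * dir (bk i))%Z.
  by rewrite E; congr addr; lia.
apply: runs_scan => [k lt_k|]; rewrite E.
  have -> : (Z.of_nat m - 1 - Z.of_nat k)%Z = Z.of_nat (m - 1 - k) by lia.
  by case: Hc => H1 _; rewrite H1 // (nth_map false) // size_rev; lia.
have -> : (Z.of_nat m - 1 - Z.of_nat m = -1)%Z by lia.
exact: (tape_of_below iK Hc).
Qed.

Lemma moves_up K i c :
  runs (moves (off K i) (fw i)) (Tape 0 c) (off K i).+1 tt (Tape (addr K i 0) c).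
Proof.
have -> : addr K i 0 = (0 + Z.of_nat (off K i) * dir (fw i))%Z by rewrite /addr; lia.
exact: runs_moves.
Qed.

Lemma moves_home K i c : i <= K ->
  runs (moves (off K i - stride K i) (bk i)) (Tape (addr K i (-1)) c) (off K i - stride K i).+1 tt
    (Tape 0 c).
Proof.
move=> iK.
have -> : 0%Z = (addr K i (-1) + Z.of_nat (off K i - stride K i) * dir (bk i))%Z.
  by rewrite /addr dir_bk /off /stride /fw; case: eqP => Hi; rewrite /dir; lia.
exact: runs_moves.
Qed.

Lemma moves_down K i j c :
  runs (moves (stride K i) (bk i)) (Tape (addr K i j) c) (stride K i).+1 tt
    (Tape (addr K i (j - 1)) c).
Proof.
have -> : addr K i (j - 1) = (addr K i j + Z.of_nat (stride K i) * dir (bk i))%Z.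
  by rewrite /addr dir_bk; lia.
exact: runs_moves.
Qed.

Lemma off_stride_le K i : i <= K -> off K i <= (2 * K).+1 /\ stride K i <= K.+1.
Proof. by rewrite /off /stride; case: eqP; lia. Qed.

Definition op_cost (K L : nat) := 20 * (K + 4) * (L + 2).

Lemma runs_push K s c i b L : i <= K -> tape_of K s c -> size (s i) <= L ->
  exists2 t, t <= op_cost K L & exists2 c', tape_of K (upd s i (b :: s i)) c' &
    runs (push K i b) (Tape 0 c) t tt (Tape 0 c').
Proof.
move=> iK Hc HL; have Hc' := tape_of_push b iK Hc.
eexists; last first.
  eexists; first exact: Hc'.
  apply: runs_bind; first exact: moves_up.
  apply: runs_bind; first exact: (scan_up iK Hc).
  apply: runs_bind; first exact: runs_prim.
  rewrite /act /= Z.add_0_r.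
  apply: runs_bind; last exact: moves_home.
  have Hsz : (size (s i)).+1 <= size (upd s i (b :: s i) i) by rewrite /upd eqxx.
  have := scan_down iK Hc' Hsz.
  have -> : (Z.of_nat (size (s i)).+1 - 1)%Z = Z.of_nat (size (s i)) by lia.
  exact.
have [] := off_stride_le iK; rewrite /op_cost; nia.
Qed.

Lemma runs_pop K s c i L : i <= K -> tape_of K s c -> size (s i) <= L ->
  exists2 t, t <= op_cost K L & exists2 c', tape_of K (upd s i (behead (s i))) c' &
    runs (pop K i) (Tape 0 c) t (ohead (s i)) (Tape 0 c').
Proof.
move=> iK Hc HL; have [Ho Hs] := off_stride_le iK.
case Es: (s i) => [|b w].
  have -> : upd s i (behead [::]) = s.
    by apply: functional_extensionality => j; rewrite /upd; case: eqP => // ->.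
  eexists; last first.
    eexists; first exact: Hc.
    apply: runs_bind; first exact: moves_up.
    apply: runs_bind; first exact: (scan_up iK Hc).
    rewrite Es; apply: runs_bind; first exact: moves_down.
    have Eb := tape_of_below iK Hc.
    apply: runs_bind; first by apply: runs_prim.
    have Ec : upd_cell c (addr K i (-1)) None = c.
      by rewrite -[RHS](upd_cell_id c (addr K i (-1))) Eb.
    rewrite /act /= Z.add_0_r Eb Ec.
    apply: runs_bind; first exact: runs_ret.
    apply: runs_bind; first exact: moves_home.
    exact: runs_ret.
  rewrite /op_cost /=; nia.
have Hc' := tape_of_pop iK Hc Es.
eexists; last first.
  eexists; first exact: Hc'.
  apply: runs_bind; first exact: moves_up.
  apply: runs_bind; first exact: (scan_up iK Hc).
  rewrite Es; apply: runs_bind; first exact: moves_down.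
  have -> : (Z.of_nat (size (b :: w)) - 1)%Z = Z.of_nat (size w)
    by rewrite -[size (b :: w)]/(size w).+1; lia.
  have Eb : c (addr K i (Z.of_nat (size w))) = Some b.
    case: Hc => H1 _; rewrite H1 // Es rev_cons map_rcons nth_rcons.
    by rewrite size_map size_rev ltnn eqxx.
  apply: runs_bind; first by apply: runs_prim.
  rewrite /act /= Z.add_0_r Eb.
  apply: runs_bind.
    apply: runs_bind; first exact: moves_down.
    by apply: (scan_down iK Hc'); rewrite /upd eqxx.
  apply: runs_bind; first exact: moves_home.
  exact: runs_ret.
have : size w < L by move: HL; rewrite Es.
rewrite /op_cost /=; nia.
Qed.

(** * A structured language of stack programs *)

(** Stacks are tested by popping. The popped bit selects the first command on [false] and the second
    on [true]; on an empty stack [Case] does nothing and [Loop] stops. *)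
Inductive cmd :=
| Push of nat & bool
| Skip
| Seq of cmd & cmd
| Case of nat & cmd & cmd
| Loop of nat & cmd & cmd.

Inductive exec : cmd -> stacks -> stacks -> nat -> Prop :=
| ExPush i b s : exec (Push i b) s (upd s i (b :: s i)) 1
| ExSkip s : exec Skip s s 1
| ExSeq c1 c2 s s1 s2 t1 t2 :
    exec c1 s s1 t1 -> exec c2 s1 s2 t2 -> exec (Seq c1 c2) s s2 (t1 + t2)
| ExCaseNil i cf ct s : s i = [::] -> exec (Case i cf ct) s s 1
| ExCaseCons i cf ct s b w s' t : s i = b :: w ->
    exec (if b then ct else cf) (upd s i w) s' t -> exec (Case i cf ct) s s' t.+1
| ExLoopNil i cf ct s : s i = [::] -> exec (Loop i cf ct) s s 1
| ExLoopCons i cf ct s b w s1 s2 t1 t2 : s i = b :: w ->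
    exec (if b then ct else cf) (upd s i w) s1 t1 ->
    exec (Loop i cf ct) s1 s2 t2 -> exec (Loop i cf ct) s s2 (t1 + t2).+1.

Fixpoint max_stack (c : cmd) : nat :=
  match c with
  | Push i _ => i
  | Skip => 0
  | Seq c1 c2 => maxn (max_stack c1) (max_stack c2)
  | Case i c1 c2 | Loop i c1 c2 => maxn i (maxn (max_stack c1) (max_stack c2))
  end.

Fixpoint compile (K : nat) (c : cmd) : pm unit :=
  match c with
  | Push i b => push K i b
  | Skip => ret tt
  | Seq c1 c2 => bind (compile K c1) (fun _ => compile K c2)
  | Case i cf ct => bind (pop K i) (fun a : sym =>
      match a with None => ret tt
      | Some b => if b then compile K ct else compile K cf end)
  | Loop i cf ct => loop (bind (pop K i) (fun a : sym =>
      match a with None => ret (Some tt)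
      | Some b => bind (if b then compile K ct else compile K cf) (fun _ => ret None) end))
  end.

(** A unit of time pushes at most one bit. The bound is needed because a stack operation on the tape
    costs time proportional to the height of the stack. *)
Lemma exec_size c s s' t L : exec c s s' t ->
  (forall i, size (s i) <= L) -> forall i, size (s' i) <= L + t.
Proof.
move=> H; elim: H L => {c s s' t}.
- by move=> i b s L Hs j; rewrite /upd; case: eqP => _ /=; have := Hs i; have := Hs j; lia.
- by move=> s L Hs j; have := Hs j; lia.
- by move=> c1 c2 s s1 s2 t1 t2 _ IH1 _ IH2 L Hs j; rewrite addnA; apply: IH2; apply: IH1.
- by move=> i cf ct s _ L Hs j; have := Hs j; lia.
- move=> i cf ct s b w s' t Es _ IH L Hs j; rewrite addnS; apply: leqW; apply: IH => k.
  by rewrite /upd; case: eqP => [_|_]; [have := Hs i; rewrite Es /=; lia | apply: Hs].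
- by move=> i cf ct s _ L Hs j; have := Hs j; lia.
move=> i cf ct s b w s1 s2 t1 t2 Es _ IH1 _ IH2 L Hs j.
rewrite addnS addnA; apply: leqW; apply: IH2; apply: IH1 => k.
by rewrite /upd; case: eqP => [_|_]; [have := Hs i; rewrite Es /=; lia | apply: Hs].
Qed.

Lemma op_cost_mono K L L' : L <= L' -> op_cost K L <= op_cost K L'.
Proof. rewrite /op_cost; nia. Qed.

Lemma upd_nil (s : stacks) i : s i = [::] -> upd s i [::] = s.
Proof. by move=> E; apply: functional_extensionality => j; rewrite /upd; case: eqP => // ->. Qed.

(** No stack grows beyond [L + t], so each unit of time pays for one operation at that height; the
    extra 2 covers the [ret] transitions of [Case] and [Loop]. *)
Lemma runs_compile K c s s' t : exec c s s' t -> max_stack c <= K ->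
  forall cs L, tape_of K s cs -> (forall i, size (s i) <= L) ->
  exists2 t', t' <= t * (op_cost K (L + t)).+2 & exists2 cs', tape_of K s' cs' &
    runs (compile K c) (Tape 0 cs) t' tt (Tape 0 cs').
Proof.
move=> H; elim: H => {c s s' t} /=.
- move=> i b s iK cs L Hc Hs.
  have [t Ht [cs' Hc' R]] := runs_push b iK Hc (Hs i).
  exists t; last by exists cs'.
  by rewrite mul1n; apply: leq_trans Ht _; apply: leqW; apply: leqW; apply: op_cost_mono; lia.
- move=> s _ cs L Hc _; exists 1; first by lia.
  by exists cs => //; apply: runs_ret.
- move=> c1 c2 s s1 s2 t1 t2 E1 IH1 E2 IH2; rewrite geq_max => /andP[K1 K2] cs L Hc Hs.
  have [t1' Ht1 [cs1 Hc1 R1]] := IH1 K1 _ _ Hc Hs.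
  have [t2' Ht2 [cs2 Hc2 R2]] := IH2 K2 _ _ Hc1 (exec_size E1 Hs).
  exists (t1' + t2'); last by exists cs2 => //; apply: runs_bind R1 R2.
  rewrite -addnA in Ht2.
  have := @op_cost_mono K (L + t1) (L + (t1 + t2)) ltac:(lia); nia.
- move=> i cf ct s Es; rewrite !geq_max => /and3P[iK K1 K2] cs L Hc Hs.
  have [t Ht [cs' Hc' R]] := runs_pop iK Hc (Hs i).
  move: Hc' R; rewrite Es /= (upd_nil Es) => Hc' R.
  exists (t + 1); last by exists cs' => //; apply: (runs_bind R); apply: runs_ret.
  have := @op_cost_mono K L (L + 1) ltac:(lia); lia.
- move=> i cf ct s b w s' t Es E IH; rewrite !geq_max => /and3P[iK K1 K2] cs L Hc Hs.
  have [t1 Ht1 [cs1 Hc1 R1]] := runs_pop iK Hc (Hs i).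
  move: Hc1 R1; rewrite Es /= => Hc1 R1.
  have Hs1 k : size (upd s i w k) <= L.
    by rewrite /upd; case: eqP => [_|_]; [have := Hs i; rewrite Es /=; lia | apply: Hs].
  have [|t2 Ht2 [cs2 Hc2 R2]] := IH _ _ _ Hc1 Hs1; first by case: ifP.
  exists (t1 + t2).
    have := @op_cost_mono K L (L + t.+1) ltac:(lia).
    have := @op_cost_mono K (L + t) (L + t.+1) ltac:(lia); nia.
  by exists cs2 => //; apply: (runs_bind R1) => /=; case: (b) R2.
- move=> i cf ct s Es; rewrite !geq_max => /and3P[iK K1 K2] cs L Hc Hs.
  have [t Ht [cs' Hc' R]] := runs_pop iK Hc (Hs i).
  move: Hc' R; rewrite Es /= (upd_nil Es) => Hc' R.
  exists (t + 1).
    have := @op_cost_mono K L (L + 1) ltac:(lia); lia.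
  by exists cs' => //; apply: runs_loop_exit; apply: (runs_bind R); apply: runs_ret.
move=> i cf ct s b w s1 s2 t1 t2 Es E1 IH1 E2 IH2 HK cs L Hc Hs.
move: (HK); rewrite !geq_max => /and3P[iK K1 K2].
have [t0 Ht0 [cs0 Hc0 R0]] := runs_pop iK Hc (Hs i).
move: Hc0 R0; rewrite Es /= => Hc0 R0.
have Hs0 k : size (upd s i w k) <= L.
  by rewrite /upd; case: eqP => [_|_]; [have := Hs i; rewrite Es /=; lia | apply: Hs].
have [|t1' Ht1 [cs1 Hc1 R1]] := IH1 _ _ _ Hc0 Hs0; first by case: ifP.
have [t2' Ht2 [cs2 Hc2 R2]] := IH2 HK _ _ Hc1 (exec_size E1 Hs0).
exists (t0 + (t1' + 1) + t2').
  have := @op_cost_mono K L (L + (t1 + t2).+1) ltac:(lia).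
  have := @op_cost_mono K (L + t1) (L + (t1 + t2).+1) ltac:(lia).
  have := @op_cost_mono K (L + t1 + t2) (L + (t1 + t2).+1) ltac:(lia).
  nia.
exists cs2 => //; apply: runs_loop_step R2.
apply: (runs_bind R0) => /=.
have R1' : runs (if b then compile K ct else compile K cf) (Tape 0 cs0) t1' tt (Tape 0 cs1).
  by case: (b) R1.
by apply: (runs_bind R1'); apply: runs_ret.
Qed.

(** * Running a machine after a stack program *)

(** Lists are read with blanks beyond their end, so configurations differing only in trailing blanks
    represent the same tape. *)
Definition represents (M : TM) (c : config M) (T : tape) : Prop :=
  [/\ c_head c = cell T (pos T),
      forall i, nth None (c_left c) i = cell T (pos T - 1 - Z.of_nat i)
    & forall i, nth None (c_right c) i = cell T (pos T + 1 + Z.of_nat i)].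

Lemma represents_step (M : TM) (c : config M) T q w mv :
  represents c T -> halted c = false ->
  tm_delta (c_state c) (cell T (pos T)) = (q, w, mv) ->
  c_state (step c) = q /\ represents (step c) (act T w mv).
Proof.
case: c T => st l h r [p cl] [/= Hh Hl Hr] nh; rewrite -Hh /step nh /= => -> {nh}.
have H0 z : z = p -> upd_cell cl p w z = w by move=> ->; rewrite /upd_cell Z.eqb_refl.
have H1 z : z <> p -> upd_cell cl p w z = cl z.
  by rewrite /upd_cell; case: Z.eqb_spec.
case: mv => /=; last first.
- split=> //; split=> [|i|i] /=; rewrite Z.add_0_r.
  + by rewrite H0.
  + by rewrite H1 ?Hl //; lia.
  + by rewrite H1 ?Hr //; lia.
- case: r Hr => [|a r] Hr; split=> //; (split=> [|[|i]|i] /=;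
    [by rewrite H1; [have := Hr 0; rewrite Z.add_0_r | lia]
    |by rewrite H0 //; lia
    |by rewrite H1 ?Hl; [congr cl; lia | lia]
    |by rewrite H1; [have := Hr i.+1 => /= E; rewrite ?nth_nil in E *; rewrite E; congr cl; lia | lia]]).
case: l Hl => [|a l] Hl; split=> //; (split=> [|i|[|i]] /=;
    [by rewrite H1; [have := Hl 0 => /= ->; congr cl; lia | lia]
    |by rewrite H1; [have := Hl i.+1 => /= E; rewrite ?nth_nil in E *; rewrite E; congr cl; lia | lia]
    |by rewrite H0 //; lia
    |by rewrite H1 ?Hr; [congr cl; lia | lia]]).
Qed.

Section Chain.
Variables (p : pm unit) (M : TM).

Notation St := (pm_st p + 'I_(tm_Q M).+1)%type.

(* The machine must start in state ord0, hence an extra state acting like the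
   start state of p. *)
Definition st_dec (q : 'I_(#|{: St}|.+1)) : St :=
  if unlift ord0 q is Some i then enum_val i else inl (pm_s0 p).
Definition st_enc (s : St) : 'I_(#|{: St}|.+1) := lift ord0 (enum_rank s).

Definition chain : TM :=
  @MkTM #|{: St}|
    (fun q a => match st_dec q with
       | inl s => let: (wm, r) := pm_d s a in
          (st_enc (match r with inl s' => inl s' | inr _ => inr ord0 end), wm.1, wm.2)
       | inr q => let: (q', w, mv) := tm_delta q a in (st_enc (inr q'), w, mv)
       end)
    (st_enc (inr (tm_acc M))) (st_enc (inr (tm_rej M))).

Lemma st_encK : cancel st_enc st_dec.
Proof. by move=> s; rewrite /st_dec /st_enc liftK enum_rankK. Qed.

Lemma chain_acc_rej : tm_acc M != tm_rej M -> tm_acc chain != tm_rej chain.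
Proof. by apply: contraNneq => /(can_inj st_encK) [->]. Qed.

Lemma chain_runs_from (s : pm_st p) T t e T' (c : config chain) :
  runs_from s T t e T' -> st_dec (c_state c) = inl s -> represents c T ->
  c_state (iter t (@step chain) c) = st_enc (inr ord0) /\
  represents (iter t (@step chain) c) T'.
Proof.
have nh (d : config chain) s' : st_dec (c_state d) = inl s' -> halted d = false.
  by move=> E; rewrite /halted; apply/negP => /orP[] /eqP Ed; move: E; rewrite Ed /= st_encK.
move=> R; elim: R c => {s T t e T'} [s T w mv e H|s T w mv s' t e T' H _ IH] c Es Hr.
  by apply: (represents_step Hr (nh _ _ Es)); rewrite /= Es H.
have [] := @represents_step chain c T (st_enc (inl s')) w mv Hr (nh _ _ Es).
  by rewrite /= Es H.
by move=> E1 E2; rewrite iterSr; apply: IH; rewrite // E1 st_encK.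
Qed.

Lemma chain_simulates t (c : config chain) (d : config M) T :
  c_state c = st_enc (inr (c_state d)) -> represents c T -> represents d T ->
  c_state (iter t (@step chain) c) = st_enc (inr (c_state (iter t (@step M) d))).
Proof.
elim: t c d T => [//|t IH] c d T E Hc Hd; rewrite !iterSr.
have Eh : halted c = halted d.
  by rewrite /halted E /= !(inj_eq (can_inj st_encK)).
case hd: (halted d).
  by rewrite /step Eh hd; apply: IH Hc Hd.
case Ed: (tm_delta (c_state d) (cell T (pos T))) => [[q w] mv].
have [Ed1 Ed2] := represents_step Hd hd Ed.
have [||Ec1 Ec2] := @represents_step chain c T (st_enc (inr q)) w mv Hc.
- by rewrite Eh.
- by rewrite /= E st_encK Ed.
by apply: IH Ec2 Ed2; rewrite Ec1 Ed1.
Qed.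
End Chain.

(** Cell 1, under the head at the start, is also the bottom of stack 0. A word [x] on the tape is
    thus the stack [rev x], its last symbol on top. *)
Definition word_tape (x : seq bool) (z : Z) : sym :=
  if Z.leb z 0 then None else nth None (map Some x) (Z.to_nat (z - 1)).

Lemma represents_init (M : TM) x : represents (init M x) (Tape 1 (word_tape x)).
Proof.
rewrite /word_tape; split=> [|i|i]; cbn [c_left c_right c_head pos cell init]; first by case: x.
  by rewrite nth_nil; case: Z.leb_spec => //; lia.
case: Z.leb_spec; first by lia.
move=> _; rewrite nth_behead; congr nth; lia.
Qed.

Lemma tape_of_word K x s : s 0 = rev x -> (forall i, 0 < i -> s i = [::]) ->
  tape_of K s (word_tape x).
Proof.
move=> E0 Es; split=> [i j iK|z Hz]; rewrite /word_tape; last by case: Z.leb_spec => //; lia.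
case: (posnP i) => [->|ip].
  rewrite addr_main E0 revK; case: Z.leb_spec; first by lia.
  by move=> _; congr nth; lia.
by rewrite Es // nth_nil addr_side //; case: Z.leb_spec => //; nia.
Qed.

Lemma tape_of_word_inv K x s c : 0 < K -> s 0 = rev x -> (forall i, 0 < i -> s i = [::]) ->
  tape_of K s c -> c = word_tape x.
Proof.
move=> Kp E0 Es [H1 H2]; apply: functional_extensionality => z; rewrite /word_tape.
case: Z.leb_spec => Hz.
  case: (Z_le_gt_dec (- Z.of_nat K) z) => Hz'; first by apply: H2; lia.
  pose q := Z.to_nat (- z - Z.of_nat K - 1).
  have lt_q : q %% K < K by rewrite ltn_mod.
  have -> : z = addr K (q %% K).+1 (Z.of_nat (q %/ K)).
    by rewrite addr_side //; have := divn_eq q K; rewrite /q; lia.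
  by rewrite H1 // Es // nth_nil.
have -> : z = addr K 0 (Z.of_nat (Z.to_nat (z - 1))) by rewrite addr_main; lia.
rewrite H1 // E0 revK addr_main; congr nth; lia.
Qed.

Lemma chain_program (c : cmd) (M : TM) :
  exists M' D, (tm_acc M != tm_rej M -> tm_acc M' != tm_rej M') /\
  forall x y t, exec c (fun i => if i == 0 then rev x else [::])
                       (fun i => if i == 0 then rev y else [::]) t ->
  exists2 t1, t1 <= D * (size x + t + 2) ^ 2 & forall t2,
    (c_state (run M t2 y) = tm_acc M -> c_state (run M' (t1 + t2) x) = tm_acc M') /\
    (c_state (run M t2 y) = tm_rej M -> c_state (run M' (t1 + t2) x) = tm_rej M').
Proof.
(* The successor makes [K] positive; without side stacks, [tape_of] would leave the negative cells
   unconstrained. *)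
pose K := (max_stack c).+1.
pose p : pm unit := bind (moves 1 MLeft) (fun _ => bind (compile K c) (fun _ => moves 1 MRight)).
exists (chain p M), (20 * (K + 4) + 6); split; first exact: chain_acc_rej.
move=> x y t Hex.
set s := (fun i => _) in Hex; set s' := (fun i => if i == 0 then rev y else _) in Hex.
have Ht : tape_of K s (word_tape x).
  by apply: tape_of_word => // i ip; rewrite /s; case: eqP ip => // ->.
have Hsz i : size (s i) <= size x by rewrite /s; case: eqP; rewrite ?size_rev.
have [t' Ht' [c' Hc' R]] := runs_compile Hex (leqnSn _) Ht Hsz.
have Ec' : c' = word_tape y.
  apply: tape_of_word_inv Hc' => // i ip; rewrite /s'; by case: eqP ip => // ->.
subst c'.
have Rp : runs p (Tape 1 (word_tape x)) (2 + (t' + 2)) tt (Tape 1 (word_tape y)).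
  apply: runs_bind; first exact: (runs_moves 1 MLeft).
  apply: runs_bind; first exact: R.
  exact: (runs_moves 1 MRight).
exists (2 + (t' + 2)).
  rewrite -mulnn; move: Ht'; rewrite /op_cost -/K.
  set A := 20 * (K + 4); set u := size x + t + 2 => Ht'.
  have tu : t <= u by rewrite /u; lia.
  have u2 : 2 <= u by rewrite /u; lia.
  have : t * (A * u).+2 <= u * (A * u).+2 by rewrite leq_mul2r tu orbT.
  have : 2 * u <= u * u by rewrite leq_mul2r u2 orbT.
  have : u * (A * u).+2 = A * (u * u) + 2 * u by lia.
  by move: Ht'; move: (A * u) (u * u) (u * _) => *; lia.
move=> t2.
have Edec : st_dec (c_state (init (chain p M) x)) = inl (pm_s0 p).
  by rewrite /st_dec /= unlift_none.
have [E1 H1] := chain_runs_from Rp Edec (represents_init _ x).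
have := @chain_simulates p M t2 _ (init M y) _ E1 H1 (represents_init M y).
rewrite -iterD addnC => E2.
by split=> E3; rewrite /run -/(run _ _ _) E2 -/(run M t2 y) E3.
Qed.

(** * Polynomial-time computable functions *)

Definition ex (P : cmd) (s s' : stacks) (T : nat) : Prop :=
  exists2 t, t <= T & exec P s s' t.

Definition un (n : nat) : seq bool := nseq n true.

Lemma ex_weak P s s' T T' : T <= T' -> ex P s s' T -> ex P s s' T'.
Proof. by move=> le [t lt H]; exists t => //; apply: leq_trans le. Qed.

Lemma ex_seq P Q s s1 s2 T1 T2 :
  ex P s s1 T1 -> ex Q s1 s2 T2 -> ex (Seq P Q) s s2 (T1 + T2).
Proof. by move=> [t1 l1 H1] [t2 l2 H2]; exists (t1 + t2); [apply: leq_add | apply: ExSeq H1 H2]. Qed.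

Lemma ex_push i b s s' : s' = upd s i (b :: s i) -> ex (Push i b) s s' 1.
Proof. by move=> ->; exists 1 => //; apply: ExPush. Qed.

Lemma ex_skip s : ex Skip s s 1.
Proof. by exists 1 => //; apply: ExSkip. Qed.

Lemma ex_for i P m (S : nat -> stacks) T :
  (forall j, j <= m -> S j i = un (m - j)) ->
  (forall j, j < m -> ex P (upd (S j) i (un (m - j.+1))) (S j.+1) T) ->
  ex (Loop i P P) (S 0) (S m) (m * T.+1).+1.
Proof.
elim: m S => [|m IH] S H1 H2.
  by exists 1 => //; apply: ExLoopNil; rewrite H1.
have [t1 l1 E1] := H2 0 isT.
have [|j lt_j|t2 l2 E2] := IH (fun j => S j.+1).
- by move=> j lt_j; rewrite H1.
- by apply: H2.
exists (t1 + t2).+1; first by lia.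
apply: (ExLoopCons (b := true) _ _ E2) => //; first by rewrite H1.
by move: E1; rewrite subSS subn0.
Qed.

Lemma upd_id (s : stacks) i w : s i = w -> upd s i w = s.
Proof. by move=> <-; apply: functional_extensionality => j; rewrite /upd; case: eqP => // ->. Qed.

Ltac stk := apply: functional_extensionality => ?; rewrite /upd;
  repeat (case: eqP => ?; subst); try lia; try done.

Ltac updE := rewrite /upd; repeat (case: eqP => ?; subst); try lia; try done.

Lemma ex_clear i s : ex (Loop i Skip Skip) s (upd s i [::]) ((size (s i)).*2.+1).
Proof.
move E: (s i) => w; elim: w s E => [|b w IH] s E.
  by rewrite upd_id //; exists 1 => //; apply: ExLoopNil.
have [|t lt H] := IH (upd s i w); first by rewrite /upd eqxx.
exists (1 + t).+1; first by rewrite /= in lt *; lia.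
apply: (ExLoopCons E _ (s1 := upd s i w)); first by case: b E => _; apply: ExSkip.
by have -> : upd s i [::] = upd (upd s i w) i [::] by stk.
Qed.

(** The input word with the values of [k] bound variables; sums and iterations bind new ones for
    their bodies. *)
Fixpoint ctx (k : nat) : Type := if k is k'.+1 then (ctx k' * nat)%type else seq bool.

Fixpoint inp (k : nat) : ctx k -> seq bool :=
  if k is k'.+1 then fun c => inp c.1 else fun c => c.

Fixpoint mag (k : nat) : ctx k -> nat :=
  if k is k'.+1 then fun c => maxn (mag c.1) c.2 else fun c => size c.

Fixpoint env_ok (k : nat) (rho : seq nat) (d : nat) : ctx k -> stacks -> Prop :=
  if k is k'.+1 then fun c s =>
    [/\ 3 <= head 0 rho, head 0 rho < d, s (head 0 rho) = un c.2
      & env_ok (behead rho) d c.1 s]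
  else fun _ _ => True.

(* Stack 1 holds the input, stack 2 is scratch space for scanning it, the
   variables of the context live in the registers rho and everything from
   register d on is free. *)
Definition pre k (rho : seq nat) (d : nat) (c : ctx k) (s : stacks) : Prop :=
  [/\ 3 <= d, s 1 = inp c, s 2 = [::], forall j, d <= j -> s j = [::]
    & env_ok rho d c s].

(** The exponent is uniform while the program depends on the registers, so that a caller can place
    the variables. The final state restores every stack but [d]. The value is bounded too, as it is
    written in unary and may serve as a loop length. *)
Definition comp k (f : ctx k -> nat) : Prop :=
  exists B, (forall c, f c <= (mag c).+2 ^ B) /\
  forall rho d, exists P, forall c s, pre rho d c s ->
    ex P s (upd s d (un (f c))) ((mag c).+2 ^ B).

Lemma size_inp k (c : ctx k) : size (inp c) <= mag c.
Proof. by elim: k c => [//|k IH] c /=; rewrite leq_max IH. Qed.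

Lemma env_ok_ext k rho d d' (c : ctx k) s s' : env_ok rho d c s -> d <= d' ->
  (forall j, j < d -> s' j = s j) -> env_ok rho d' c s'.
Proof.
elim: k rho c => [//|k IH] rho c /= [H1 H2 H3 H4] le H; split=> //.
- exact: leq_trans H2 le.
- by rewrite H.
exact: IH H4 le H.
Qed.

Lemma pre_ext k rho d d' (c : ctx k) s s' : pre rho d c s -> d <= d' ->
  (forall j, j < d -> s' j = s j) -> (forall j, d' <= j -> s' j = [::]) ->
  pre rho d' c s'.
Proof.
move=> [H1 H2 H3 H4 H5] le E1 E2; split=> //.
- exact: leq_trans H1 le.
- by rewrite E1 ?H2; last lia.
- by rewrite E1 ?H3; last lia.
exact: env_ok_ext H5 le E1.
Qed.

Lemma pre_cons k rho d d' r i (c : ctx k) s s' : pre rho d c s -> d <= r < d' ->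
  s' r = un i ->
  (forall j, j < d -> s' j = s j) -> (forall j, d' <= j -> s' j = [::]) ->
  pre (k := k.+1) (r :: rho) d' (c, i) s'.
Proof.
move=> Hp /andP[ler ltr] Er E1 E2.
have [] := pre_ext Hp (ltnW (leq_ltn_trans ler ltr)) E1 E2.
move=> ? ? ? ? ?; split=> //; split=> //=.
by case: Hp => d3 *; apply: leq_trans ler.
Qed.

Lemma comp_ext k (f g : ctx k -> nat) : f =1 g -> comp f -> comp g.
Proof.
move=> E [B [H1 H2]]; exists B; split=> [c|rho d]; first by rewrite -E.
by have [P HP] := H2 rho d; exists P => c s Hp; rewrite -E; apply: HP.
Qed.

(** * Polynomial bounds *)

Definition polyb (u : nat -> nat) : Prop := exists B, forall m, u m <= m.+2 ^ B.

Lemma expn_base_mono a b B : a <= b -> a ^ B <= b ^ B.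
Proof. by move=> le; case: B => // B; rewrite leq_exp2r. Qed.

Lemma polyb_const a : polyb (fun _ => a).
Proof.
exists a => m; apply: ltnW; apply: (@leq_trans (2 ^ a)); first exact: ltn_expl.
exact: expn_base_mono.
Qed.

Lemma polyb_id : polyb id.
Proof. by exists 1 => m; rewrite expn1 /=; lia. Qed.

Lemma polyb_mul u v : polyb u -> polyb v -> polyb (fun m => u m * v m).
Proof. by move=> [A HA] [B HB]; exists (A + B) => m; rewrite expnD leq_mul. Qed.

Lemma polyb_add u v : polyb u -> polyb v -> polyb (fun m => u m + v m).
Proof.
move=> [A HA] [B HB]; exists (1 + maxn A B) => m; rewrite expnD expn1.
have := leq_trans (HA m) (leq_pexp2l (ltn0Sn m.+1) (leq_maxl A B)).
have := leq_trans (HB m) (leq_pexp2l (ltn0Sn m.+1) (leq_maxr A B)).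
by move: (_ ^ _) => e; nia.
Qed.

Lemma polyb_exp u B : polyb u -> polyb (fun m => (u m) ^ B).
Proof. by move=> [A HA]; exists (A * B) => m; rewrite expnM expn_base_mono. Qed.

Lemma polyb_succ u : polyb u -> polyb (fun m => (u m).+1).
Proof.
move=> Hu; have [B HB] := polyb_add Hu (polyb_const 1).
by exists B => m; rewrite -addn1.
Qed.

Lemma polyb_maxn u v : polyb u -> polyb v -> polyb (fun m => maxn (u m) (v m)).
Proof.
move=> Hu Hv; have [B HB] := polyb_add Hu Hv.
by exists B => m; apply: leq_trans (HB m); rewrite geq_max leq_addr leq_addl.
Qed.

Lemma compI k (f : ctx k -> nat) :
  (exists2 V, polyb V & forall c, f c <= V (mag c)) ->
  (exists2 T, polyb T & forall rho d, exists P, forall c s, pre rho d c s ->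
    ex P s (upd s d (un (f c))) (T (mag c))) -> comp f.
Proof.
move=> [V HV HfV] [T HT Hex].
have [B HB] := polyb_add HV HT.
exists B; split=> [c|rho d].
  by apply: leq_trans (HB _); apply: leq_trans (HfV c) (leq_addr _ _).
have [P HP] := Hex rho d; exists P => c s Hp.
by apply: ex_weak (HP _ _ Hp); apply: leq_trans (HB _); apply: leq_addl.
Qed.

Lemma polyb_pow B : polyb (fun m => m.+2 ^ B).
Proof. by exists B. Qed.

#[export] Hint Resolve polyb_const polyb_id polyb_mul polyb_add polyb_exp polyb_succ polyb_maxn polyb_pow : polyb.

(** * Closure properties: variables, sums, iterated subtraction, input bits *)

Lemma comp_const k a : @comp k (fun _ => a).
Proof.
apply: compI; first by exists (fun _ => a); auto with polyb.
exists (fun _ => a.+1); first by auto with polyb.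
move=> rho d; exists (iter a (Seq (Push d true)) Skip) => c s [_ _ _ Hd _].
have {Hd} : s d = un 0 by rewrite Hd.
suff H : forall b, s d = un b -> ex (iter a (Seq (Push d true)) Skip) s (upd s d (un (b + a))) a.+1.
  by move/H.
elim: a s => [|a IH] s b E; first by rewrite addn0 upd_id //; apply: ex_skip.
rewrite -[a.+2]add1n /=; apply: ex_seq; first exact: ex_push.
have -> : upd s d (un (b + a.+1)) = upd (upd s d (true :: s d)) d (un (b.+1 + a)).
  by rewrite addSnnS; stk.
by apply: IH; rewrite /upd eqxx E.
Qed.

Lemma comp_weak k (f : ctx k -> nat) : comp f -> @comp k.+1 (fun p => f p.1).
Proof.
move=> [B [H1 H2]].
have le (c : ctx k.+1) : (mag c.1).+2 ^ B <= (mag c).+2 ^ B.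
  by apply: expn_base_mono; rewrite !ltnS /= leq_maxl.
exists B; split=> [c|rho d]; first exact: leq_trans (H1 _) (le c).
have [P HP] := H2 (behead rho) d; exists P => c s [? ? ? ? [? ? ? ?]].
by apply: ex_weak (le c) _; apply: HP.
Qed.

(** Reading a register empties it, so it is copied to both [d] and [d.+1], and the second copy is
    poured back. *)
Lemma comp_var k : @comp k.+1 (fun p => p.2).
Proof.
apply: compI; first by exists id; [auto with polyb | move=> c /=; rewrite leq_maxr].
exists (fun m => m * 3 + 1 + (m * 2 + 1)); first by auto 10 with polyb.
move=> rho d; pose r := head 0 rho.
exists (Seq (Loop r (Seq (Push d true) (Push d.+1 true)) (Seq (Push d true) (Push d.+1 true)))
            (Loop d.+1 (Push r true) (Push r true))).
move=> c s [d3 _ _ Hd [r3 rd Hr _]]; rewrite -/r in r3 rd Hr.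
have Hm : c.2 <= mag c by rewrite /= leq_maxr.
move: (c.2) Hr Hm => v Hr Hm.
apply: (@ex_weak _ _ _ (v * 3 + 1 + (v * 2 + 1))); first by lia.
apply: (@ex_seq _ _ _ (upd (upd (upd s d (un v)) d.+1 (un v)) r [::])); rewrite addn1.
  have := @ex_for r (Seq (Push d true) (Push d.+1 true)) v
    (fun j => upd (upd (upd s d (un j)) d.+1 (un j)) r (un (v - j))) 2.
  rewrite subnn subn0.
  have -> : upd (upd (upd s d (un 0)) d.+1 (un 0)) r (un v) = s.
    by stk; rewrite ?Hd ?Hr //; lia.
  apply=> [j _|j lt_j]; first by rewrite /upd eqxx.
  rewrite -[2]/(1 + 1); apply: ex_seq; first exact: ex_push.
  by apply: ex_push; stk; by updE.
have := @ex_for d.+1 (Push r true) v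
    (fun j => upd (upd (upd s d (un v)) d.+1 (un (v - j))) r (un j)) 1.
rewrite subnn subn0.
have -> : upd (upd (upd s d (un v)) d.+1 (un 0)) r (un v) = upd s d (un v).
  by stk; rewrite ?Hd ?Hr //; lia.
apply=> [j _|j lt_j]; first by updE.
by apply: ex_push; stk; by updE.
Qed.

Lemma comp_add k (f g : ctx k -> nat) : comp f -> comp g -> comp (fun c => f c + g c).
Proof.
move=> [A [A1 A2]] [B [B1 B2]].
apply: compI.
  exists (fun m => m.+2 ^ A + m.+2 ^ B); first by auto with polyb.
  by move=> c; apply: leq_add.
exists (fun m => m.+2 ^ A + (m.+2 ^ B + (m.+2 ^ B * 2 + 1))); first by auto 10 with polyb.
move=> rho d; have [P HP] := A2 rho d; have [Q HQ] := B2 rho d.+1.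
exists (Seq P (Seq Q (Loop d.+1 (Push d true) (Push d true)))) => c s Hp.
have [d3 _ _ Hd _] := Hp.
apply: ex_seq; first exact: HP.
apply: ex_seq.
  apply: HQ; apply: (pre_ext Hp) => // j Hj; updE.
  by apply: Hd; lia.
apply: (@ex_weak _ _ _ (g c * 2 + 1)); first by have := B1 c; lia.
have := @ex_for d.+1 (Push d true) (g c)
    (fun j => upd (upd s d (un (f c + j))) d.+1 (un (g c - j))) 1.
rewrite subnn subn0 addn0 addn1.
have -> : upd (upd s d (un (f c + g c))) d.+1 (un 0) = upd s d (un (f c + g c)).
  by stk; rewrite Hd //; lia.
apply=> [j _|j lt_j]; first by updE.
by apply: ex_push; rewrite addnS; stk; by updE.
Qed.

Section Iterate.
Variables (Q Pe : cmd) (op : nat -> nat) (A h : nat -> nat) (m T V d : nat) (s : stacks).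

Let st a b i := upd (upd (upd s d (un a)) d.+1 (un b)) d.+2 (un i).

(** Common skeleton of sums and iterated subtraction: [d] accumulates, [d.+1] counts down, [d.+2] is
    the index seen by the body, and [d.+3] receives [h j], the number of times that [Q] acts on
    [d]. *)
Lemma ex_iterate :
  (forall s' a, s' d = un a -> ex Q s' (upd s' d (un (op a))) 2) ->
  (forall j, j < m -> A j.+1 = iter (h j) op (A j)) ->
  (forall j, j < m -> h j <= V) ->
  (forall j, d <= j -> s j = [::]) ->
  (forall j, j < m -> ex Pe (st (A j) (m - j.+1) j) (upd (st (A j) (m - j.+1) j) d.+3 (un (h j))) T) ->
  let body := Seq Pe (Seq (Loop d.+3 Q Q) (Push d.+2 true)) in
  ex (Seq (Loop d.+1 body body) (Loop d.+2 Skip Skip))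
    (upd (upd s d (un (A 0))) d.+1 (un m)) (upd s d (un (A m)))
    (m * (T + (V * 3 + 2)).+1 + 1 + (m * 2 + 1)).
Proof.
move=> HQ HA HV Hd HP body.
apply: (@ex_seq _ _ _ (st (A m) 0 m)); rewrite addn1; last first.
  have -> : upd s d (un (A m)) = upd (st (A m) 0 m) d.+2 [::].
    by rewrite /st; stk; rewrite Hd //; lia.
  apply: ex_weak (ex_clear _ _).
  by rewrite /st /upd eqxx size_nseq; lia.
have -> : upd (upd s d (un (A 0))) d.+1 (un m) = st (A 0) m 0.
  by rewrite /st; stk; rewrite Hd //; lia.
have := @ex_for d.+1 body m (fun j => st (A j) (m - j) j) (T + (V * 3 + 2)).
rewrite subnn subn0; apply=> [j _|j lt_j]; first by rewrite /st; updE.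
have -> : upd (st (A j) (m - j) j) d.+1 (un (m - j.+1)) = st (A j) (m - j.+1) j.
  by rewrite /st; stk.
apply: ex_seq; first exact: HP.
apply: (@ex_weak _ _ _ (h j * 3 + 1 + 1)); first by have := HV j lt_j; lia.
apply: (@ex_seq _ _ _ (st (A j.+1) (m - j.+1) j)); last first.
  by apply: ex_push; rewrite /st; stk.
have := @ex_for d.+3 Q (h j)
  (fun i => upd (st (iter i op (A j)) (m - j.+1) j) d.+3 (un (h j - i))) 2.
rewrite subnn subn0 addn1 -HA //.
have -> : upd (st (A j.+1) (m - j.+1) j) d.+3 (un 0) = st (A j.+1) (m - j.+1) j.
  by rewrite /st; stk; rewrite Hd //; lia.
apply=> [i _|i lt_i]; first by updE.
set s1 := upd _ _ (un (_ - i.+1)).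
have -> : upd (st (iter i.+1 op (A j)) (m - j.+1) j) d.+3 (un (h j - i.+1))
          = upd s1 d (un (op (iter i op (A j)))) by rewrite /s1 /st; stk.
by apply: HQ; rewrite /s1 /st; updE.
Qed.
End Iterate.

Lemma comp_sum k (f : ctx k -> nat) (g : ctx k -> nat -> nat) :
  comp f -> @comp k.+1 (fun p => g p.1 p.2) -> comp (fun c => \sum_(i < f c) g c i).
Proof.
move=> [A [A1 A2]] [B [B1 B2]].
have B1' c i : i < f c -> g c i <= (maxn (mag c) ((mag c).+2 ^ A)).+2 ^ B.
  move=> lt_i; apply: leq_trans (B1 (c, i)) _; apply: expn_base_mono.
  rewrite !ltnS /= geq_max leq_maxl /= leq_max; apply/orP; right.
  exact: leq_trans (ltnW lt_i) (A1 c).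
apply: compI.
  exists (fun m => m.+2 ^ A * (maxn m (m.+2 ^ A)).+2 ^ B); first by auto 10 with polyb.
  move=> c; apply: (@leq_trans (\sum_(i < f c) (maxn (mag c) ((mag c).+2 ^ A)).+2 ^ B)).
    by apply: leq_sum => i _; apply: B1'.
  by rewrite sum_nat_const card_ord leq_mul2r A1 orbT.
pose W m := (maxn m (m.+2 ^ A)).+2 ^ B.
exists (fun m => m.+2 ^ A + (m.+2 ^ A * (W m + (W m * 3 + 2)).+1 + 1 + (m.+2 ^ A * 2 + 1))).
  by rewrite /W; auto 20 with polyb.
(* The summand finds its index in register [d.+2] and works from [d.+3] on. *)
move=> rho d; have [P HP] := A2 rho d.+1; have [Q HQ] := B2 (d.+2 :: rho) d.+3.
pose body := Seq Q (Seq (Loop d.+3 (Push d true) (Push d true)) (Push d.+2 true)).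
exists (Seq P (Seq (Loop d.+1 body body) (Loop d.+2 Skip Skip))) => c s Hp.
have [d3 _ _ Hd _] := Hp.
apply: ex_seq.
  by apply: HP; apply: (pre_ext Hp) => // j Hj; apply: Hd; lia.
pose acc j := \sum_(i < j) g c i.
have -> : upd s d.+1 (un (f c)) = upd (upd s d (un (acc 0))) d.+1 (un (f c)).
  by rewrite /acc big_ord0; stk; rewrite Hd.
apply: (@ex_weak _ _ _ (f c * (W (mag c) + (W (mag c) * 3 + 2)).+1 + 1 + (f c * 2 + 1))).
  by rewrite !leq_add ?leq_mul ?A1.
apply: (@ex_iterate (Push d true) Q S acc (g c) (f c) (W (mag c)) (W (mag c)) d s).
- by move=> s' a E; apply: (@ex_weak _ _ _ 1) => //; apply: ex_push; rewrite E.
- by move=> j _; rewrite /acc big_ord_recr /= -[iter _ _ _]/(iter _ succn _) iter_succn addnC.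
- by move=> j; apply: B1'.
- exact: Hd.
move=> j lt_j; apply: (@ex_weak _ _ _ ((mag ((c, j) : ctx k.+1)).+2 ^ B)).
  apply: expn_base_mono; rewrite !ltnS /= geq_max leq_maxl /= leq_max; apply/orP; right.
  exact: leq_trans (ltnW lt_j) (A1 c).
apply: (HQ (c, j)).
apply: (@pre_cons _ _ d d.+3 d.+2 _ _ _ _ Hp); try by lia.
- by updE.
- by move=> i Hi; updE.
by move=> i Hi; updE; apply: Hd; lia.
Qed.

Lemma comp_mul k (f g : ctx k -> nat) : comp f -> comp g -> comp (fun c => f c * g c).
Proof.
move=> Hf Hg; apply: (@comp_ext _ (fun c => \sum_(i < f c) g c)).
  by move=> c; rewrite sum_nat_const card_ord.
by apply: (comp_sum (g := fun c _ => g c)) => //; apply: comp_weak.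
Qed.

(** A step may inspect the current value but can only lower it, so all values stay below [a].
    Unrestricted iteration could double a value at each step and leave the polynomial range. *)
Fixpoint itsub (h : nat -> nat -> nat) (a m : nat) : nat :=
  if m is m'.+1 then itsub h a m' - h m' (itsub h a m') else a.

Lemma itsub_le h a m : itsub h a m <= a.
Proof. by elim: m => //= m IH; apply: leq_trans (leq_subr _ _) IH. Qed.

Lemma comp_itsub k (f m : ctx k -> nat) (h : ctx k -> nat -> nat -> nat) :
  comp f -> comp m -> @comp k.+2 (fun p => h p.1.1 p.1.2 p.2) ->
  comp (fun c => itsub (h c) (f c) (m c)).
Proof.
move=> [A [A1 A2]] [D [D1 D2]] [B [B1 B2]].
pose W m := (maxn (maxn m (m.+2 ^ D)) (m.+2 ^ A)).+2 ^ B.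
have Hmag c j a : j < m c -> a <= f c ->
    (mag ((c, j, a) : ctx k.+2)).+2 ^ B <= W (mag c).
  move=> lt_j le_a; apply: expn_base_mono; rewrite !ltnS /= !geq_max !leq_max leqnn /=.
  by rewrite (leq_trans (ltnW lt_j) (D1 c)) (leq_trans le_a (A1 c)) !orbT.
apply: compI.
  exists (fun m => m.+2 ^ A); first by auto with polyb.
  by move=> c; apply: leq_trans (itsub_le _ _ _) (A1 c).
exists (fun m => m.+2 ^ A + (m.+2 ^ D + (m.+2 ^ D * (W m + (W m * 3 + 2)).+1 + 1 + (m.+2 ^ D * 2 + 1)))).
  by rewrite /W; auto 20 with polyb.
move=> rho d; have [P HP] := A2 rho d; have [R HR] := D2 rho d.+1.
(* Here the body also sees the accumulator [d], as its innermost variable. *)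
have [Q HQ] := B2 (d :: d.+2 :: rho) d.+3.
pose drp := Case d Skip Skip.
pose body := Seq Q (Seq (Loop d.+3 drp drp) (Push d.+2 true)).
exists (Seq P (Seq R (Seq (Loop d.+1 body body) (Loop d.+2 Skip Skip)))) => c s Hp.
have [d3 _ _ Hd _] := Hp.
apply: ex_seq; first exact: HP.
apply: ex_seq.
  by apply: HR; apply: (pre_ext Hp) => // j Hj; updE; apply: Hd; lia.
pose acc j := itsub (h c) (f c) j.
apply: (@ex_weak _ _ _ (m c * (W (mag c) + (W (mag c) * 3 + 2)).+1 + 1 + (m c * 2 + 1))).
  by rewrite !leq_add ?leq_mul ?D1.
apply: (@ex_iterate drp Q predn acc (fun j => h c j (acc j)) (m c) (W (mag c)) (W (mag c)) d s).
- move=> s' a E; case: a E => [|a] E.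
    by rewrite upd_id //; exists 1 => //; apply: ExCaseNil.
  by exists 2 => //; apply: (ExCaseCons E); apply: ExSkip.
- by move=> j _; rewrite /acc /= -[iter _ _ _]/(iter _ predn _) iter_predn.
- move=> j lt_j; apply: leq_trans (B1 (c, j, acc j)) (Hmag _ _ _ lt_j _).
  exact: itsub_le.
- exact: Hd.
move=> j lt_j; apply: ex_weak (Hmag _ _ _ lt_j (itsub_le _ _ _)) _.
apply: (HQ (c, j, acc j)).
have Hp' : pre (k := k.+1) (d.+2 :: rho) d.+3 (c, j)
    (upd (upd (upd s d (un (acc j))) d.+1 (un (m c - j.+1))) d.+2 (un j)).
  apply: (@pre_cons _ _ d d.+3 d.+2 _ _ _ _ Hp); try by lia.
  - by updE.
  - by move=> i Hi; updE.
  by move=> i Hi; updE; apply: Hd; lia.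
case: Hp' => H1 H2 H3 H4 H5; split=> //; split=> //=; by [lia | updE].
Qed.

Lemma comp_sub k (f g : ctx k -> nat) : comp f -> comp g -> comp (fun c => f c - g c).
Proof.
move=> Hf Hg.
apply: (@comp_itsub k f (fun _ => 1) (fun c _ _ => g c)) => //; first exact: comp_const.
by apply: (@comp_weak k.+1 (fun p => g p.1)); apply: comp_weak.
Qed.

Lemma ex_restore s v w : s 1 = v -> s 2 = w ->
  ex (Loop 2 (Push 1 false) (Push 1 true)) s (upd (upd s 1 (catrev w v)) 2 [::]) (size w * 2 + 1).
Proof.
elim: w v s => [|b w IH] v s E1 E2.
  have -> : upd (upd s 1 (catrev [::] v)) 2 [::] = s by stk.
  by exists 1 => //; apply: ExLoopNil.
have [||t lt H] := IH (b :: v) (upd (upd s 2 w) 1 (b :: v)) => //.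
exists (1 + t).+1; first by rewrite /= in lt *; lia.
have -> : upd (upd s 1 (catrev (b :: w) v)) 2 [::] =
  upd (upd (upd (upd s 2 w) 1 (b :: v)) 1 (catrev w (b :: v))) 2 [::] by stk.
apply: (ExLoopCons E2 _ H).
have -> : upd (upd s 2 w) 1 (b :: v) = upd (upd s 2 w) 1 (b :: upd s 2 w 1).
  by rewrite -E1 /upd.
by case: (b); apply: ExPush.
Qed.

Lemma comp_size k : @comp k (fun c => size (inp c)).
Proof.
apply: compI; first by exists id; [auto with polyb | apply: size_inp].
exists (fun m => m * 3 + 1 + (m * 2 + 1)); first by auto 10 with polyb.
move=> rho d.
exists (Seq (Loop 1 (Seq (Push 2 false) (Push d true)) (Seq (Push 2 true) (Push d true)))
            (Loop 2 (Push 1 false) (Push 1 true))).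
move=> c s [d3 H1 H2 Hd _].
apply: (@ex_weak _ _ _ (size (inp c) * 3 + 1 + (size (inp c) * 2 + 1))).
  by have := size_inp c; lia.
move: (inp c) H1 => x H1.
apply: (@ex_seq _ _ _ (upd (upd (upd s d (un (size x))) 2 (rev x)) 1 [::])); last first.
  have E : upd s d (un (size x)) =
    upd (upd (upd (upd (upd s d (un (size x))) 2 (rev x)) 1 [::]) 1 (catrev (rev x) [::])) 2 [::].
    by stk; rewrite ?catrevE ?revK ?cats0.
  have := @ex_restore (upd (upd (upd s d (un (size x))) 2 (rev x)) 1 [::]) [::] (rev x) erefl erefl.
  by rewrite size_rev -E.
have E0 : s d = un 0 by rewrite Hd.
suff H : forall x w n s, s 1 = x -> s 2 = w -> s d = un n ->
  ex (Loop 1 (Seq (Push 2 false) (Push d true)) (Seq (Push 2 true) (Push d true))) s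
     (upd (upd (upd s d (un (n + size x))) 2 (catrev x w)) 1 [::]) (size x * 3 + 1).
  exact: H H1 H2 E0.
elim=> [|b y IH] w n s0 E1 E2 E3.
  have -> : upd (upd (upd s0 d (un (n + 0))) 2 (catrev [::] w)) 1 [::] = s0.
    by rewrite addn0; stk.
  by exists 1 => //; apply: ExLoopNil.
have [|||t lt H] := IH (b :: w) n.+1 (upd (upd (upd s0 1 y) 2 (b :: w)) d (un n.+1));
  try by updE.
exists (2 + t).+1; first by rewrite /= in lt *; lia.
have -> : upd (upd (upd s0 d (un (n + size (b :: y)))) 2 (catrev (b :: y) w)) 1 [::] =
  upd (upd (upd (upd (upd (upd s0 1 y) 2 (b :: w)) d (un n.+1)) d (un (n.+1 + size y))) 2
     (catrev y (b :: w))) 1 [::] by rewrite addSnnS; stk.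
apply: (ExLoopCons E1 _ H).
have -> : upd (upd (upd s0 1 y) 2 (b :: w)) d (un n.+1) =
  upd (upd (upd s0 1 y) 2 (b :: upd s0 1 y 2)) d (true :: upd (upd s0 1 y) 2 (b :: upd s0 1 y 2) d).
  by stk; rewrite ?E3.
by case: (b); apply: (@ExSeq _ _ _ _ _ 1 1); apply: ExPush.
Qed.

Lemma comp_nth k (f : ctx k -> nat) : comp f ->
  comp (fun c => nth false (inp c) (f c) : nat).
Proof.
move=> [A [A1 A2]]; apply: compI.
  by exists (fun _ => 1); [auto with polyb | move=> c; case: nth].
exists (fun m => m.+2 ^ A + (m.+2 ^ A * 3 + 1 + (3 + (m * 2 + 1)))); first by auto 20 with polyb.
move=> rho d; have [P HP] := A2 rho d.+1.
exists (Seq P (Seq (Loop d.+1 (Case 1 (Push 2 false) (Push 2 true)) (Case 1 (Push 2 false) (Push 2 true)))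
   (Seq (Case 1 (Push 2 false) (Seq (Push 2 true) (Push d true))) (Loop 2 (Push 1 false) (Push 1 true))))).
move=> c s Hp; have [d3 H1 H2 Hd _] := Hp.
apply: ex_seq.
  by apply: HP; apply: (pre_ext Hp) => // j Hj; apply: Hd; lia.
have := A1 c; have := size_inp c; move: (inp c) (f c) H1 => x v H1 Hx Hv.
pose st j := upd (upd s 1 (drop j x)) 2 (rev (take j x)).
apply: (@ex_weak _ _ _ (v * 3 + 1 + (3 + (size (take v.+1 x) * 2 + 1)))).
  by rewrite size_take; case: ifP => ?; lia.
apply: (@ex_seq _ _ _ (st v)).
  have := @ex_for d.+1 (Case 1 (Push 2 false) (Push 2 true)) v (fun j => upd (st j) d.+1 (un (v - j))) 2.
  rewrite subnn subn0 addn1.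
  have -> : upd (st v) d.+1 (un 0) = st v by rewrite /st; stk; rewrite Hd //; lia.
  have -> : upd (st 0) d.+1 (un v) = upd s d.+1 (un v).
    by rewrite /st drop0 take0; stk.
  apply=> [j _|j lt_j]; first by updE.
  have [lt_jx|le_xj] := ltnP j (size x); last first.
    exists 1 => //.
    have -> : upd (st j.+1) d.+1 (un (v - j.+1)) = upd (upd (st j) d.+1 (un (v - j))) d.+1 (un (v - j.+1)).
      by rewrite /st !drop_oversize ?take_oversize; [stk|lia..].
    by apply: ExCaseNil; rewrite /st drop_oversize; [updE | lia].
  exists 2 => //; apply: (ExCaseCons (b := nth false x j) (w := drop j.+1 x)).
    by rewrite /st -drop_nth //; updE.
  set s1 := upd (upd (upd _ _ _) _ _) _ _.
  have -> : upd (st j.+1) d.+1 (un (v - j.+1)) = upd s1 2 (nth false x j :: s1 2).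
    by rewrite /s1 /st (take_nth false) // rev_rcons; stk.
  by case: nth; apply: ExPush.
apply: (@ex_seq _ _ _ (upd (st v.+1) d (un (nth false x v)))); last first.
  have E : upd s d (un (nth false x v)) = upd (upd (upd (st v.+1) d (un (nth false x v))) 1
      (catrev (rev (take v.+1 x)) (drop v.+1 x))) 2 [::].
    by rewrite /st; stk; rewrite catrevE revK cat_take_drop.
  rewrite E -[X in ex _ _ _ (X * 2 + 1)]size_rev.
  by apply: ex_restore; rewrite /st; updE.
(* Past the end of the input, [Case] finds stack 1 empty and leaves [d] empty, the unary form of the
   default [false]. *)
have [lt_vx|le_xv] := ltnP v (size x); last first.
  exists 1 => //; rewrite nth_default //.
  have -> : upd (st v.+1) d (un false) = st v.
    by rewrite /st !drop_oversize ?take_oversize; try lia; stk; rewrite Hd //; lia.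
  by apply: ExCaseNil; rewrite /st drop_oversize //; updE.
set b := nth false x v; exists (if b then 3 else 2); first by case: b.
have -> : (if b then 3 else 2) = (if b then 2 else 1).+1 by case: b.
apply: (ExCaseCons (b := b) (w := drop v.+1 x)).
  by rewrite /st /b -drop_nth //; updE.
set s1 := upd (st v) _ _.
have E1 : upd s1 2 (b :: s1 2) = st v.+1.
  by rewrite /s1 /st (take_nth false) // rev_rcons -/b; stk.
case Eb: b E1 => E1.
  apply: (@ExSeq _ _ _ _ _ 1 1); first exact: ExPush.
  have -> : upd (st v.+1) d (un true) = upd (upd s1 2 (true :: s1 2)) d (true :: upd s1 2 (true :: s1 2) d).
    by rewrite E1 /st; stk; rewrite Hd.
  exact: ExPush.
have -> : upd (st v.+1) d (un false) = upd s1 2 (false :: s1 2).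
  by rewrite E1 /st; stk; rewrite Hd //; lia.
exact: ExPush.
Qed.

(** * Boolean and arithmetic functions *)

Lemma comp_weak2 k (f : ctx k -> nat) : comp f -> @comp k.+2 (fun p => f p.1.1).
Proof. by move=> H; apply: (@comp_weak k.+1 (fun p => f p.1)); apply: comp_weak. Qed.

Lemma comp_succ k (f : ctx k -> nat) : comp f -> comp (fun c => (f c).+1).
Proof.
move=> H; apply: (@comp_ext _ (fun c => f c + 1)); first by move=> c; rewrite addn1.
by apply: comp_add => //; apply: comp_const.
Qed.

Lemma comp_leq k (f g : ctx k -> nat) : comp f -> comp g -> comp (fun c => f c <= g c : nat).
Proof.
move=> Hf Hg; apply: (@comp_ext _ (fun c => 1 - (f c - g c))); first by move=> c; lia.
by apply: comp_sub; [apply: comp_const | apply: comp_sub].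
Qed.

Lemma comp_and k (f g : ctx k -> bool) :
  comp (fun c => f c : nat) -> comp (fun c => g c : nat) -> comp (fun c => f c && g c : nat).
Proof.
move=> Hf Hg; apply: (@comp_ext _ (fun c => f c * g c)); first by move=> c; rewrite mulnb.
exact: comp_mul.
Qed.

Lemma comp_not k (f : ctx k -> bool) : comp (fun c => f c : nat) -> comp (fun c => ~~ f c : nat).
Proof.
move=> Hf; apply: (@comp_ext _ (fun c => 1 - f c)); first by move=> c; case: (f c).
by apply: comp_sub => //; apply: comp_const.
Qed.

Lemma comp_or k (f g : ctx k -> bool) :
  comp (fun c => f c : nat) -> comp (fun c => g c : nat) -> comp (fun c => f c || g c : nat).
Proof.
move=> Hf Hg; apply: (@comp_ext _ (fun c => ~~ (~~ f c && ~~ g c))).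
  by move=> c; case: (f c); case: (g c).
by apply: comp_not; apply: comp_and; apply: comp_not.
Qed.

Lemma comp_eq k (f g : ctx k -> nat) : comp f -> comp g -> comp (fun c => f c == g c : nat).
Proof.
move=> Hf Hg; apply: (@comp_ext _ (fun c => (f c <= g c) && (g c <= f c))).
  by move=> c; rewrite eqn_leq.
by apply: comp_and; apply: comp_leq.
Qed.

Lemma comp_if k (b : ctx k -> bool) (f g : ctx k -> nat) :
  comp (fun c => b c : nat) -> comp f -> comp g -> comp (fun c => if b c then f c else g c).
Proof.
move=> Hb Hf Hg; apply: (@comp_ext _ (fun c => b c * f c + ~~ b c * g c)).
  by move=> c; case: (b c); rewrite /= ?mul1n ?mul0n ?addn0.
by apply: comp_add; apply: comp_mul => //; apply: comp_not.
Qed.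

Lemma comp_ifb k (b f g : ctx k -> bool) :
  comp (fun c => b c : nat) -> comp (fun c => f c : nat) -> comp (fun c => g c : nat) ->
  comp (fun c => (if b c then f c else g c) : nat).
Proof.
move=> Hb Hf Hg; apply: (comp_ext _ (comp_if Hb Hf Hg)).
by move=> c; case: (b c).
Qed.

Lemma sum_lt_ord n m : \sum_(i < n) (i < m : nat) = minn n m.
Proof.
elim: n => [|n IH]; first by rewrite big_ord0 min0n.
by rewrite big_ord_recr /= IH; lia.
Qed.

(** The quotient counts the q with (q + 1) g <= f; the guard [0 < g] yields 0 for a zero divisor, in
    agreement with [divn]. *)
Lemma comp_div k (f g : ctx k -> nat) : comp f -> comp g -> comp (fun c => f c %/ g c).
Proof.
move=> Hf Hg.
apply: (@comp_ext _ (fun c => \sum_(q < f c) (0 < g c) && (q.+1 * g c <= f c))).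
  move=> c; case: (posnP (g c)) => [->|gp]; first by rewrite divn0 big1.
  rewrite (eq_bigr (fun q : 'I_(f c) => q < f c %/ g c : nat)).
    by rewrite sum_lt_ord; apply/minn_idPr; apply: leq_div.
  by move=> q _; rewrite leq_divRL.
apply: (comp_sum (g := fun c q => (0 < g c) && (q.+1 * g c <= f c) : nat)) => //.
apply: comp_and; apply: comp_leq.
- exact: comp_const.
- exact: comp_weak.
- by apply: comp_mul; [apply: comp_succ; apply: comp_var | apply: comp_weak].
exact: comp_weak.
Qed.

Lemma comp_mod k (f g : ctx k -> nat) : comp f -> comp g -> comp (fun c => f c %% g c).
Proof.
move=> Hf Hg; apply: (@comp_ext _ (fun c => f c - f c %/ g c * g c)).
  by move=> c; rewrite {1}(divn_eq (f c) (g c)) addKn.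
by apply: comp_sub => //; apply: comp_mul => //; apply: comp_div.
Qed.

(** The power 2 ^ g can be exponentially large and is never computed: [f] is halved [g] times
    instead. *)
Lemma comp_shift k (f g : ctx k -> nat) : comp f -> comp g -> comp (fun c => f c %/ 2 ^ g c).
Proof.
move=> Hf Hg; apply: (@comp_ext _ (fun c => itsub (fun _ a => a - a %/ 2) (f c) (g c))).
  move=> c; elim: (g c) => [|m IH] /=; first by rewrite divn1.
  by rewrite IH subKn ?leq_div // expnSr divnMA.
apply: (comp_itsub (h := fun _ _ a => a - a %/ 2)) => //.
by apply: comp_sub; [|apply: comp_div; [|apply: comp_const]]; apply: comp_var.
Qed.

Lemma comp_has k (f : ctx k -> nat) (b : ctx k -> nat -> bool) :
  comp f -> @comp k.+1 (fun p => b p.1 p.2 : nat) ->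
  comp (fun c => has (b c) (iota 0 (f c)) : nat).
Proof.
move=> Hf Hb; apply: (@comp_ext _ (fun c => 0 < \sum_(i < f c) (b c i : nat))).
  move=> c; congr nat_of_bool; rewrite lt0n sum_nat_eq0 negb_forall.
  apply/existsP/hasP => [[i]|[i]].
    by rewrite eqb0 negbK => Hi; exists (val i) => //; rewrite mem_iota /=.
  by rewrite mem_iota /= => lt_i Hi; exists (Ordinal lt_i); rewrite eqb0 negbK.
apply: comp_leq; first exact: comp_const.
exact: (comp_sum (g := fun c i => b c i : nat)).
Qed.

(** * Computing a word bit by bit *)

Lemma exec_load x s w : s 0 = rev x -> s 1 = w ->
  ex (Loop 0 (Push 1 false) (Push 1 true)) s (upd (upd s 0 [::]) 1 (x ++ w)) (size x * 2 + 1).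
Proof.
elim/last_ind: x w s => [|x b IH] w s E0 E1.
  have -> : upd (upd s 0 [::]) 1 ([::] ++ w) = s by stk.
  by exists 1 => //; apply: ExLoopNil.
rewrite rev_rcons in E0.
have [||t lt H] := IH (b :: w) (upd (upd s 0 (rev x)) 1 (b :: w)) => //.
exists (1 + t).+1; first by rewrite size_rcons; lia.
have -> : upd (upd s 0 [::]) 1 (rcons x b ++ w) =
  upd (upd (upd (upd s 0 (rev x)) 1 (b :: w)) 0 [::]) 1 (x ++ b :: w) by rewrite cat_rcons; stk.
apply: (ExLoopCons E0 _ H).
have -> : upd (upd s 0 (rev x)) 1 (b :: w) = upd (upd s 0 (rev x)) 1 (b :: upd s 0 (rev x) 1).
  by rewrite -E1.
by case: (b); apply: ExPush.
Qed.

Lemma transducer (len : ctx 0 -> nat) (bit : ctx 1 -> bool) :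
  comp len -> comp (fun p => bit p : nat) ->
  exists P B, forall x, let y := mkseq (fun i => bit (x, i)) (len x) in
    size y <= (size x).+2 ^ B /\
    ex P (fun i => if i == 0 then rev x else [::])
         (fun i => if i == 0 then rev y else [::]) ((size x).+2 ^ B).
Proof.
move=> [A [A1 A2]] [D [D1 D2]].
have [Pl HPl] := A2 [::] 3; have [Pb HPb] := D2 [:: 4] 5.
(* A computed bit is a unary number, with 0 the empty stack, whereas [Case] branches on a stored
   symbol. So [false] is put on stack 6 and flipped once if the bit is 1. *)
pose flip := Seq (Case 6 Skip Skip) (Push 6 true).
pose out := Seq (Push 6 false) (Seq (Loop 5 flip flip) (Seq (Case 6 (Push 0 false) (Push 0 true)) (Push 4 true))).
pose body := Seq Pb out.
pose P := Seq (Loop 0 (Push 1 false) (Push 1 true)) (Seq Pl (Seq (Loop 3 body body)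
  (Seq (Loop 4 Skip Skip) (Loop 1 Skip Skip)))).
pose W m := (maxn m (m.+2 ^ A)).+2 ^ D.
have [B HB] : polyb (fun m => m.+2 ^ A +
    (m * 2 + 1 + (m.+2 ^ A + (m.+2 ^ A * (W m + 20).+1 + 1 + (m.+2 ^ A * 2 + 1 + (m * 2 + 1)))))).
  by rewrite /W; auto 20 with polyb.
exists P, B => x y; have Hl := A1 x.
split.
  by rewrite size_mkseq; apply: leq_trans (HB _); apply: leq_trans (leq_addr _ _).
apply: ex_weak; first by apply: leq_trans (HB _); apply: leq_addl.
set s0 := (fun i : nat => _).
pose st b i := upd (upd (upd (upd s0 0 (rev (mkseq (fun i => bit (x, i)) i))) 1 x) 3 (un b)) 4 (un i).
have s0E i : 0 < i -> s0 i = [::] by rewrite /s0; case: eqP => // ->.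
apply: (@ex_seq _ _ _ (upd (upd s0 0 [::]) 1 x)).
  by have := @exec_load x s0 [::] erefl erefl; rewrite cats0.
have Hp3 : pre [::] 3 (x : ctx 0) (upd (upd s0 0 [::]) 1 x).
  by split=> // j Hj; updE; apply: s0E; lia.
apply: ex_seq; first exact: HPl Hp3.
apply: (@ex_seq _ _ _ (st 0 (len x))); last first.
  apply: (@ex_weak _ _ _ ((len x).*2.+1 + (size x).*2.+1)); first by rewrite /= in Hl *; lia.
  apply: (@ex_seq _ _ _ (upd (st 0 (len x)) 4 [::])).
    have := ex_clear 4 (st 0 (len x)).
    have -> : size (st 0 (len x) 4) = len x by rewrite /st /upd /= size_nseq.
    exact.
  have := ex_clear 1 (upd (st 0 (len x)) 4 [::]).
  have -> : upd (upd (st 0 (len x)) 4 [::]) 1 [::] =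
     (fun i => if i == 0 then rev y else [::]).
    by rewrite /st; stk; apply: s0E; lia.
  exact.
apply: (@ex_weak _ _ _ ((len x) * (W (size x) + 20).+1).+1).
  by rewrite addn1 ltnS leq_mul2r Hl orbT.
have := @ex_for 3 body (len x) (fun j => st (len x - j) j) (W (size x) + 20).
rewrite subnn subn0.
have -> : st (len x) 0 = upd (upd (upd s0 0 [::]) 1 x) 3 (un (len x)).
  by rewrite /st; stk.
apply=> [j _|j lt_j]; first by rewrite /st; updE.
have -> : upd (st (len x - j) j) 3 (un (len x - j.+1)) = st (len x - j.+1) j.
  by rewrite /st; stk.
set s1 := st _ j.
apply: ex_seq.
  apply: (@ex_weak _ _ _ ((mag ((x, j) : ctx 1)).+2 ^ D)).
    apply: expn_base_mono; rewrite !ltnS /= geq_max leq_maxl /= leq_max; apply/orP; right.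
    exact: leq_trans (ltnW lt_j) Hl.
  apply: (HPb (x, j)).
  have Hp3' : pre [::] 3 (x : ctx 0) (upd (upd s0 0 (s1 0)) 1 x).
    by split=> // i Hi; updE; apply: s0E; lia.
  apply: (pre_cons Hp3' (r := 4)) => //.
  - by case=> [|[|[|i]]].
  by move=> i Hi; rewrite /s1 /st; updE; apply: s0E; lia.
set b := bit (x, j); set s2 := upd s1 5 (un b).
apply: (@ex_weak _ _ _ (1 + (((b : nat) * 4).+1 + (2 + 1)))); first by case: (b).
apply: (@ex_seq _ _ _ (upd s2 6 [:: false])).
  by apply: ex_push; rewrite /s2 /s1 /st; stk; rewrite {1}/upd /= s0E.
have s15 : s1 5 = [::] by rewrite /s1 /st; updE.
have s16 : s1 6 = [::] by rewrite /s1 /st; updE.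
apply: (@ex_seq _ _ _ (upd s1 6 [:: b])).
  have := @ex_for 5 flip b (fun i => upd (upd s1 5 (un (b - i))) 6 [:: i == 1]) 3.
  rewrite subnn subn0.
  have -> : upd (upd s1 5 (un 0)) 6 [:: (b : nat) == 1] = upd s1 6 [:: b].
    by rewrite eqb1; stk.
  apply=> [i _|i]; first by updE.
  case: (b) => // ; case: i => // _.
  rewrite -[3]/(2 + 1); apply: (@ex_seq _ _ _ (upd s1 5 (un 0))).
    exists 2 => //; apply: (ExCaseCons (b := false) (w := [::])) => //.
    have -> : upd s1 5 (un 0) = upd (upd (upd (upd s1 5 (un (true - 0))) 6 [:: 0 == 1]) 5 (un (true - 1))) 6 [::].
      by stk.
    exact: ExSkip.
  by apply: ex_push; stk.
apply: (@ex_seq _ _ _ (upd s1 0 (b :: s1 0))).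
  exists 2 => //; apply: (ExCaseCons (b := b) (w := [::])) => //.
  have -> : upd s1 0 (b :: s1 0) = upd (upd (upd s1 6 [:: b]) 6 [::]) 0 (b :: upd (upd s1 6 [:: b]) 6 [::] 0).
    by stk.
  by case: (b); apply: ExPush.
apply: ex_push; rewrite /s1 /st; stk.
by rewrite mkseqS rev_rcons.
Qed.

(** * Reading a formula off its encoding *)

(** The length of the run of ones starting at [q]: the index [i] counts iff the i + 1 bits from [q]
    on are all ones. *)
Definition ones (x : seq bool) (q : nat) : nat :=
  \sum_(i < size x) (\sum_(j < i.+1) nth false x (q + j) == i.+1 : nat).

Definition nv (x : seq bool) : nat := ones x 0.

(** The number of bits left after [k] literals, tracked in place of the position because [itsub] can
    only decrease. A literal takes a sign bit, its run of ones and a closing zero, hence [+ 2];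
    after the last literal the value stays 0. *)
Definition remaining (x : seq bool) (k : nat) : nat :=
  itsub (fun _ a => ones x (size x - a).+1 + 2) (size x - (nv x).+1) k.

(* The variable i with sign b is numbered 2 i + b. *)
Definition lit (x : seq bool) (k : nat) : nat :=
  2 * ones x (size x - remaining x k).+1 + nth false x (size x - remaining x k).

Definition code (n l1 l2 l3 : nat) : nat := (l1 * (2 * n) + l2) * (2 * n) + l3.

Definition present (x : seq bool) (y : nat) : bool :=
  has (fun j => (0 < remaining x (3 * j)) &&
    (code (nv x) (lit x (3 * j)) (lit x (3 * j + 1)) (lit x (3 * j + 2)) == y)) (iota 0 (size x)).

Lemma comp_ones k (f : ctx k -> nat) : comp f -> comp (fun c => ones (inp c) (f c)).
Proof.
move=> Hf; apply: (comp_sum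
  (g := fun c i => \sum_(j < i.+1) nth false (inp c) (f c + j) == i.+1 : nat)).
  exact: comp_size.
apply: comp_eq; last by apply: comp_succ; apply: comp_var.
apply: (@comp_sum k.+1 (fun p => p.2.+1) (fun p j => nth false (inp p) (f p.1 + j) : nat)).
  by apply: comp_succ; apply: comp_var.
apply: (@comp_nth k.+2 (fun p => f p.1.1 + p.2)).
by apply: comp_add; [apply: comp_weak2 | apply: comp_var].
Qed.

Lemma comp_nv k : @comp k (fun c => nv (inp c)).
Proof. by apply: comp_ones; apply: comp_const. Qed.

Lemma comp_remaining k (f : ctx k -> nat) : comp f -> comp (fun c => remaining (inp c) (f c)).
Proof.
move=> Hf.
apply: (comp_itsub (h := fun c _ a => ones (inp c) (size (inp c) - a).+1 + 2)) => //.
  by apply: comp_sub; [apply: comp_size | apply: comp_succ; apply: comp_nv].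
apply: comp_add; last exact: comp_const.
apply: (@comp_ones k.+2 (fun p => (size (inp p) - p.2).+1)).
by apply: comp_succ; apply: comp_sub; [apply: comp_size | apply: comp_var].
Qed.

Lemma comp_lit k (f : ctx k -> nat) : comp f -> comp (fun c => lit (inp c) (f c)).
Proof.
move=> Hf.
have Hp : comp (fun c => size (inp c) - remaining (inp c) (f c)).
  by apply: comp_sub; [apply: comp_size | apply: comp_remaining].
apply: comp_add; last exact: comp_nth.
by apply: comp_mul; [apply: comp_const | apply: comp_ones; apply: comp_succ].
Qed.

Lemma comp_present k (f : ctx k -> nat) : comp f -> comp (fun c => present (inp c) (f c) : nat).
Proof.
move=> Hf; apply: (comp_has (b := fun c j => (0 < remaining (inp c) (3 * j)) &&
    (code (nv (inp c)) (lit (inp c) (3 * j)) (lit (inp c) (3 * j + 1)) (lit (inp c) (3 * j + 2)) == f c))).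
  exact: comp_size.
have H3 : @comp k.+1 (fun p => 3 * p.2) by apply: comp_mul; [apply: comp_const | apply: comp_var].
have H3' a : @comp k.+1 (fun p => 3 * p.2 + a) by apply: comp_add => //; apply: comp_const.
have Hn : @comp k.+1 (fun p => 2 * nv (inp p)) by apply: comp_mul; [apply: comp_const | apply: comp_nv].
apply: comp_and.
  by apply: comp_leq; [apply: comp_const | apply: (comp_remaining H3)].
apply: comp_eq; last exact: comp_weak.
apply: comp_add; last exact: (comp_lit (H3' 2)).
apply: comp_mul => //; apply: comp_add; last exact: (comp_lit (H3' 1)).
by apply: comp_mul => //; apply: (comp_lit H3).
Qed.

Lemma ones_run x q a w : drop q x = nseq a true ++ false :: w -> ones x q = a.
Proof.
move=> E.
have Ha : a < size x.
  have := congr1 size E; rewrite size_drop size_cat size_nseq /=; lia.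
rewrite /ones (eq_bigr (fun i : 'I_(size x) => i < a : nat)).
  by rewrite sum_lt_ord; apply/minn_idPr; apply: ltnW.
have Hn j : j <= a -> nth false x (q + j) = (j < a).
  by move=> le; rewrite -nth_drop E nth_cat size_nseq nth_nseq; case: ltngtP le => // -> _; rewrite subnn.
move=> i _; congr nat_of_bool; case: ltnP => Hi.
  apply/eqP; rewrite (eq_bigr (fun _ => 1)) ?sum_nat_const ?card_ord ?muln1 //.
  by move=> j _; rewrite Hn; have := ltn_ord j; lia.
(* From [a] on, the window contains the zero at offset [a], so its sum falls short. *)
apply/negbTE; rewrite neq_ltn; apply/orP; left.
have lt_a : a < i.+1 by [].
rewrite (bigD1 (Ordinal lt_a)) //= Hn // ltnn add0n ltnS.
apply: (@leq_trans (\sum_(j < i.+1 | j != Ordinal lt_a) 1)).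
  by apply: leq_sum => j _; case: nth.
by rewrite sum1_card cardC1 card_ord.
Qed.

Section Parse.
Variable phi : cnf3.
Notation n := (nvars phi).
Let x := enc_cnf3 phi.

Definition clause_lits (c : 'I_n * bool * ('I_n * bool) * ('I_n * bool)) : seq ('I_n * bool) :=
  [:: c.1.1; c.1.2; c.2].
Let lits := flatten [seq clause_lits c | c <- clauses phi].

Lemma enc_cnf3E : x = unary n ++ flatten [seq enc_lit l | l <- lits].
Proof.
rewrite /x /enc_cnf3 /lits; congr (_ ++ _); elim: (clauses phi) => //= c cs ->.
by rewrite -catA cat_cons -catA.
Qed.

Lemma nvE : nv x = n.
Proof. by apply: (@ones_run _ _ _ (flatten [seq enc_lit l | l <- lits])); rewrite drop0 enc_cnf3E -catA. Qed.

Lemma remainingE k : remaining x k = size (flatten [seq enc_lit l | l <- drop k lits]).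
Proof.
rewrite /remaining nvE; elim: k => [|k IH].
  by rewrite /= drop0 {1}enc_cnf3E size_cat /unary size_cat size_nseq /= addn1 addKn.
rewrite [itsub _ _ _]/= IH.
have [lt_k|le_k] := ltnP k (size lits); last by rewrite !drop_oversize // ltnW.
case El: lits lt_k => [//|l0 ls]; rewrite -El => lt_k.
rewrite (drop_nth l0) //= size_cat; set l := nth l0 lits k; set r := size (flatten _).
suff -> : ones x (size x - (size (enc_lit l) + r)).+1 = l.1.
  by rewrite /enc_lit /= /unary size_cat size_nseq /=; lia.
have Ex : x = (unary n ++ flatten [seq enc_lit l | l <- take k lits])
   ++ enc_lit l ++ flatten [seq enc_lit l | l <- drop k.+1 lits].
  by rewrite enc_cnf3E -catA -{1}(cat_take_drop k lits) map_cat flatten_cat (drop_nth l0).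
have Es : size x - (size (enc_lit l) + r) = size (unary n ++ flatten [seq enc_lit l | l <- take k lits]).
  by rewrite {1}Ex !size_cat -/r; lia.
apply: (@ones_run _ _ _ (flatten [seq enc_lit l | l <- drop k.+1 lits])).
rewrite Es -addn1 addnC -drop_drop {1}Ex drop_size_cat // /enc_lit /= drop0.
by rewrite /unary -catA.
Qed.

Lemma litE l0 k : k < size lits ->
  lit x k = 2 * (nth l0 lits k).1 + (nth l0 lits k).2.
Proof.
move=> lt_k; set l := nth l0 lits k.
have Ex : x = (unary n ++ flatten [seq enc_lit l | l <- take k lits])
   ++ enc_lit l ++ flatten [seq enc_lit l | l <- drop k.+1 lits].
  by rewrite enc_cnf3E -catA -{1}(cat_take_drop k lits) map_cat flatten_cat (drop_nth l0).
have Es : size x - remaining x k = size (unary n ++ flatten [seq enc_lit l | l <- take k lits]).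
  by rewrite remainingE (drop_nth l0) // map_cons -/l {1}Ex -[flatten (_ :: _)]/(_ ++ flatten _) !size_cat; lia.
rewrite /lit Es; congr (2 * _ + nat_of_bool _).
  apply: (@ones_run _ _ _ (flatten [seq enc_lit l | l <- drop k.+1 lits])).
  rewrite -addn1 addnC -drop_drop {1}Ex drop_size_cat // /enc_lit /= drop0.
  by rewrite /unary -catA.
by rewrite {1}Ex nth_cat ltnn subnn.
Qed.

Definition lit_nat (l : 'I_n * bool) : nat := 2 * l.1 + l.2.

Definition clause_code (c : 'I_n * bool * ('I_n * bool) * ('I_n * bool)) : nat :=
  code n (lit_nat c.1.1) (lit_nat c.1.2) (lit_nat c.2).

Lemma nth_lits l0 c0 j r : j < size (clauses phi) -> r < 3 ->
  nth l0 lits (3 * j + r) = nth l0 (clause_lits (nth c0 (clauses phi) j)) r.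
Proof.
rewrite /lits; elim: (clauses phi) j => [//|c cs IH] [|j].
  by move=> _; case: r {IH} => [|[|[|]]].
by move=> lt_j lt_r; rewrite mulnS [nth c0 _ _]/= -IH.
Qed.

Lemma size_lits : size lits = 3 * size (clauses phi).
Proof. by rewrite /lits; elim: (clauses phi) => //= c cs IH; rewrite IH; lia. Qed.

Lemma size_clauses_le : size (clauses phi) <= size x.
Proof.
rewrite enc_cnf3E size_cat; apply: leq_trans (leq_addl _ _).
apply: (@leq_trans (size lits)); first by rewrite size_lits; lia.
elim: (lits) => // l ls IH; rewrite -[size (l :: ls)]add1n.
by rewrite -[flatten _]/(enc_lit l ++ flatten [seq enc_lit l | l <- ls]) size_cat leq_add.
Qed.

Lemma presentP y : reflect (exists2 c, c \in clauses phi & clause_code c = y) (present x y).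
Proof.
have Hrem j : (0 < remaining x (3 * j)) = (j < size (clauses phi)).
  rewrite remainingE; case: (ltnP j) => Hj.
    case El: lits => [|l0 ls]; first by move: size_lits Hj; rewrite El; case: (size (clauses phi)).
    by rewrite -El (drop_nth l0) ?size_lits ?ltn_mul2l //= size_cat /enc_lit.
  by rewrite drop_oversize // size_lits leq_mul2l.
have Hc c0 j : j < size (clauses phi) ->
    code (nv x) (lit x (3 * j)) (lit x (3 * j + 1)) (lit x (3 * j + 2)) =
    clause_code (nth c0 (clauses phi) j).
  move=> lt_j; have l0 := c0.2.
  have lt_r r : r < 3 -> 3 * j + r < size lits by rewrite size_lits; lia.
  rewrite nvE -{1}[3 * j]addn0 !(litE l0) ?lt_r // !(nth_lits _ c0) //.
apply: (iffP hasP) => [[j _]|[c cin <-]].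
  rewrite Hrem => /andP[lt_j /eqP].
  case Ec: (clauses phi) lt_j => [//|c0 cs]; rewrite -Ec => lt_j.
  by rewrite (Hc c0) // => <-; exists (nth c0 (clauses phi) j) => //; apply: mem_nth.
exists (index c (clauses phi)).
  by rewrite mem_iota /= add0n; apply: leq_trans size_clauses_le; rewrite index_mem.
by rewrite Hrem index_mem cin (Hc c) ?index_mem // nth_index /=.
Qed.
End Parse.

(** * The gadgets *)

(* There is one block of 16 vertices 16 x + i for each x < (2n)^3.  As a variable,
   block x owns i = 0, 1 (its two literals, false and true) and i = 2, 3 (a pair
   forcing one literal into the solution).  As a clause, it owns for each
   s = 1, 2, 3 a selector i = 4 s, a vertex i = 4 s + 1 forcing two of the three
   selectors, and a pair i = 4 s + 2, 4 s + 3 attached to the s-th literal and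
   to the selector. *)
Section Gadget.
Variables (n : nat) (pr : pred nat).

Definition nblocks : nat := 2 * n * (2 * n) * (2 * n).
Definition nmain : nat := 16 * nblocks.

(** The literals of clause number [x], as digits in base 2 n with the most significant first: the
    inverse of [code]. *)
Definition digit (x s : nat) : nat :=
  (if s == 1 then x %/ (2 * n * (2 * n)) else if s == 2 then x %/ (2 * n) else x) %% (2 * n).

Definition lit_vertex (l : nat) : nat := 16 * (l %/ 2) + l %% 2.

(** The forest, with fixed points as roots. In a block, 0 - 2 - 1 is a path rooted at 0 and 3 is
    isolated; a selector 4 s is a root with children 4 s + 1 and 4 s + 3, while 4 s + 2 hangs from
    the literal. *)
Definition parent (y : nat) : nat :=
  if y %% 16 < 4 then
    (if y %% 16 == 1 then y.+1 else if y %% 16 == 2 then y - 2 else y)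
  else if y %% 4 == 2 then lit_vertex (digit (y %/ 16) (y %% 16 %/ 4))
  else if y %% 4 == 3 then y - 3
  else y - y %% 4.

(** A bound on the depth: literal vertices have rank 0 or 2, so what hangs from them gets 3. *)
Definition rank (y : nat) : nat :=
  if y %% 16 < 4 then (if y %% 16 == 1 then 2 else (y %% 16 == 2 : nat))
  else if y %% 4 == 2 then 3 else (y %% 4 != 0 : nat).

(** Equal values mean equal codes, hence no help from the hubs. The three forcing vertices of a
    block share one code, so that two of them can be told apart only by a selector. *)
Definition rep (y : nat) : nat :=
  if y %% 16 < 4 then (if y %% 16 == 3 then y - 1 else y)
  else if y %% 4 == 1 then 16 * (y %/ 16) + 5
  else if (y %% 4 == 3) && pr (y %/ 16) then y - 1 else y.

Definition adj (y z : nat) : bool :=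
  (y != z) && ((parent y == z) || (parent z == y)).

Lemma adjC y z : adj y z = adj z y.
Proof. by rewrite /adj eq_sym orbC. Qed.

Lemma digit_lt x s : 0 < n -> digit x s < 2 * n.
Proof. by move=> np; rewrite /digit ltn_mod; lia. Qed.

Lemma nmain_gt0 y : y < nmain -> 0 < n /\ n <= nblocks.
Proof. rewrite /nmain /nblocks; case: (posnP n) => [->|np] //; nia. Qed.

Lemma lit_vertex_lt l : 0 < n -> l < 2 * n -> lit_vertex l < nmain.
Proof.
move=> np ll; have : n <= nblocks by rewrite /nblocks; nia.
by rewrite /lit_vertex /nmain; lia.
Qed.

Lemma parent_lt y : y < nmain -> parent y < nmain.
Proof.
move=> ly; have [np nX] := nmain_gt0 ly; rewrite /parent.
have ? := lit_vertex_lt np (digit_lt (y %/ 16) (y %% 16 %/ 4) np).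
by repeat case: ifP => ?; try lia; move: ly; rewrite /nmain; lia.
Qed.

Lemma rank_parent y : parent y != y -> rank (parent y) < rank y.
Proof.
rewrite /parent /rank /lit_vertex; move: (digit _ _) => l.
by repeat case: ifP; lia.
Qed.

Lemma parent_eq t y : parent t = y -> t != y ->
  (y %% 16 = 2 /\ t.+1 = y) \/ y %% 16 = 0 \/ y %% 16 = 1 \/ (4 <= y %% 16 /\ y %% 4 = 0).
Proof.
move=> <-; rewrite /parent /lit_vertex; move: (digit _ _) => l.
by repeat case: ifP; lia.
Qed.

Lemma adj_leaf t y : y %% 16 = 3 \/ (4 <= y %% 16 /\ y %% 4 <> 0) ->
  adj t y = (t != y) && (parent y == t).
Proof.
move=> Hy; rewrite /adj; case: eqP => //= Hty.
case: (parent t =P y) => //= Et; have := parent_eq Et; move/eqP: Hty => Hty /(_ Hty); lia.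
Qed.

Lemma parent_y_1 y : 4 <= y %% 16 -> y %% 4 = 1 -> parent y = y - 1.
Proof. by rewrite /parent => *; repeat case: ifP => ?; lia. Qed.

Lemma parent_y_3 y : 4 <= y %% 16 -> y %% 4 = 3 -> parent y = y - 3.
Proof. by rewrite /parent => *; repeat case: ifP => ?; lia. Qed.

Lemma parent_y_2 y : 4 <= y %% 16 -> y %% 4 = 2 ->
  parent y = lit_vertex (digit (y %/ 16) (y %% 16 %/ 4)).
Proof. by rewrite /parent => *; repeat case: ifP => ?; lia. Qed.

Lemma adj_y_1 t y : 4 <= y %% 16 -> y %% 4 = 1 -> adj t y = (t == y - 1).
Proof. by move=> H1 H2; rewrite adj_leaf ?parent_y_1 //; lia. Qed.

Lemma adj_y_3 t y : 4 <= y %% 16 -> y %% 4 = 3 -> adj t y = (t == y - 3).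
Proof. by move=> H1 H2; rewrite adj_leaf ?parent_y_3 //; lia. Qed.

Lemma adj_y_2 t y : 4 <= y %% 16 -> y %% 4 = 2 ->
  adj t y = (t == lit_vertex (digit (y %/ 16) (y %% 16 %/ 4))).
Proof.
move=> H1 H2; rewrite adj_leaf ?parent_y_2 //; last by lia.
by rewrite /lit_vertex; lia.
Qed.

Lemma adj_a' t y : y %% 16 = 3 -> adj t y = false.
Proof.
move=> H1; rewrite adj_leaf; last by left.
by rewrite /parent; repeat case: ifP => ?; lia.
Qed.

Lemma adj_a t y : y %% 16 = 2 -> adj t y = (t == y - 2) || (t == y - 1).
Proof.
move=> H1; have E : parent y = y - 2 by rewrite /parent; repeat case: ifP => ?; lia.
rewrite /adj E; apply/andP/orP => [[Ht]|].
  case/orP => /eqP Et; last by left; rewrite Et.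
  by have := parent_eq Et Ht; lia.
case=> /eqP ->; first by split; lia.
split; first by lia.
by apply/orP; left; rewrite /parent; repeat case: ifP => ?; lia.
Qed.

Lemma rep_class y z : y < z -> rep y = rep z ->
  [\/ y %% 16 = 2 /\ z = y.+1,
      [/\ y %% 4 = 1, z %% 4 = 1, 4 <= y %% 16, 4 <= z %% 16 & y %/ 16 = z %/ 16]
    | [/\ y %% 4 = 2, 4 <= y %% 16, z = y.+1 & pr (y %/ 16)]].
Proof.
move=> lyz; rewrite /rep.
case Hy: (y %% 16 < 4); case Hz: (z %% 16 < 4).
- by repeat case: ifP => ?; move=> ?; apply: Or31; lia.
- by repeat case: ifP => ?; lia.
- by repeat case: ifP => ?; lia.
case Hy1: (y %% 4 == 1); case Hz1: (z %% 4 == 1).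
- by move=> ?; apply: Or32; split; lia.
- by case: ifP => ?; lia.
- by case: ifP => ?; lia.
case: ifP => Hy3; case: ifP => Hz3; try lia.
move=> E; apply: Or33; case/andP: Hz3 => Hz3 Hp; split; try lia.
by have -> : y %/ 16 = z %/ 16 by lia.
Qed.

Lemma rep_lt y : y < nmain -> rep y < nmain.
Proof. by rewrite /rep /nmain => ?; repeat case: ifP => ?; lia. Qed.

(** * Soundness and completeness of the gadgets *)

Definition separates (S : pred nat) (y z : nat) : Prop :=
  exists t, [/\ t < nmain, S t & adj t y != adj t z].

Definition coded_sat : Prop :=
  exists f : pred nat, forall x, x < nblocks -> pr x ->
    exists2 s, 0 < s < 4 & f (digit x s %/ 2) = odd (digit x s).

Lemma sum_blocks (F : nat -> nat) m :
  \sum_(y < 16 * m) F y = \sum_(x < m) \sum_(j < 16) F (16 * x + j).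
Proof.
elim: m => [|m IH]; first by rewrite muln0 !big_ord0.
by rewrite mulnS addnC big_split_ord /= IH [RHS]big_ord_recr.
Qed.

Lemma sum_ge_const (F : nat -> nat) c m : (forall x, x < m -> c <= F x) -> c * m <= \sum_(x < m) F x.
Proof.
move=> H; apply: (@leq_trans (\sum_(x < m) c)); first by rewrite sum_nat_const card_ord mulnC.
by apply: leq_sum => x _; apply: H.
Qed.

(** Turns the global budget into an exact count for each block. *)
Lemma sum_eq_const (F : nat -> nat) c m : (forall x, x < m -> c <= F x) ->
  \sum_(x < m) F x <= c * m -> forall x, x < m -> F x = c.
Proof.
elim: m => [//|m IH] H; rewrite big_ord_recr /= mulnS => le x.
have Hm : c * m <= \sum_(x < m) F x by apply: sum_ge_const => z lz; apply: H; lia.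
have H1 := H m (ltnSn _).
have le1 := leq_trans (leq_add Hm (leqnn (F m))) le.
have le2 := leq_trans (leq_add (leqnn _) H1) le.
rewrite ltnS leq_eqVlt => /orP[/eqP ->|lx]; first by lia.
by apply: IH => // [z lz|]; [apply: H; lia | move: le2; rewrite addnC leq_add2l].
Qed.

Lemma vertex_lt x i : x < nblocks -> i < 16 -> 16 * x + i < nmain.
Proof. by rewrite /nmain; lia. Qed.

Lemma rep_var x : rep (16 * x + 2) = rep (16 * x + 3).
Proof. by rewrite /rep; repeat case: ifP => ?; lia. Qed.

Lemma rep_force x s : 0 < s < 4 -> rep (16 * x + (4 * s + 1)) = 16 * x + 5.
Proof. by rewrite /rep => ?; repeat case: ifP => ?; lia. Qed.

Lemma rep_pair x s : 0 < s < 4 -> pr x ->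
  rep (16 * x + (4 * s + 2)) = rep (16 * x + (4 * s + 3)).
Proof.
move=> hs px; rewrite /rep; have -> : (16 * x + (4 * s + 3)) %/ 16 = x by lia.
by rewrite px; repeat case: ifP => ?; lia.
Qed.

Lemma sum16 (F : nat -> nat) : \sum_(j < 16) F j =
  (F 0 + F 1 + F 2 + F 3) + (F 4 + F 5 + F 8 + F 9 + F 12 + F 13) +
  (F 6 + F 7 + F 10 + F 11 + F 14 + F 15).
Proof. by rewrite -(big_mkord xpredT F) /index_iota /= !big_cons big_nil; lia. Qed.

Lemma two_of_three (a b c d e f : bool) : [|| a, b, c | d] -> [|| a, b, e | f] ->
  [|| c, d, e | f] -> 1 < a + b + c + d + e + f.
Proof. by case: a; case: b; case: c; case: d; case: e; case: f. Qed.

(** Each block needs one of its vertices 0 to 3 and two among its selectors and forcing vertices. A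
    budget of 3 per block is thus spent exactly there: at most one literal of each variable is in S,
    no vertex of a literal pair is, and some selector is missing. The pair at that selector can be
    separated only by a literal vertex in S. *)
Lemma coded_sat_sound (S : pred nat) :
  (forall y z, y < nmain -> z < nmain -> y != z -> rep y = rep z -> ~~ S y -> ~~ S z ->
     separates S y z) ->
  \sum_(y < nmain) S y <= 3 * nblocks -> coded_sat.
Proof.
move=> Hsep Hsum.
have Hvar x : x < nblocks -> [|| S (16 * x + 0), S (16 * x + 1), S (16 * x + 2) | S (16 * x + 3)].
  move=> lx; apply/negPn/negP; rewrite !negb_or => /and4P[H0 H1 H2 H3].
  have [t [_ St]] : separates S (16 * x + 2) (16 * x + 3).
    by apply: Hsep => //; [exact: vertex_lt|exact: vertex_lt|rewrite eqn_add2l|exact: rep_var].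
  rewrite adj_a ?adj_a'; [|lia|lia].
  case: (t =P _) => [Et|_].
    by move: St; rewrite Et (_ : 16 * x + 2 - 2 = 16 * x + 0) ?(negbTE H0) //; lia.
  case: (t =P _) => [Et|_ //].
  by move: St; rewrite Et (_ : 16 * x + 2 - 1 = 16 * x + 1) ?(negbTE H1) //; lia.
have Hcl x s1 s2 : x < nblocks -> 0 < s1 < 4 -> 0 < s2 < 4 -> s1 != s2 ->
   [|| S (16 * x + 4 * s1), S (16 * x + (4 * s1 + 1)), S (16 * x + 4 * s2) | S (16 * x + (4 * s2 + 1))].
  move=> lx h1 h2 ne; apply/negPn/negP; rewrite !negb_or => /and4P[H0 H1 H2 H3].
  have [t [_ St]] : separates S (16 * x + (4 * s1 + 1)) (16 * x + (4 * s2 + 1)).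
    apply: Hsep => //; [apply: vertex_lt => //; lia|apply: vertex_lt => //; lia|lia|].
    by rewrite !rep_force.
  rewrite !adj_y_1; [|lia|lia|lia|lia].
  case: (t =P _) => [Et|_].
    by move: St; rewrite Et (_ : 16 * x + (4 * s1 + 1) - 1 = 16 * x + 4 * s1) ?(negbTE H0) //; lia.
  case: (t =P _) => [Et|_ //].
  by move: St; rewrite Et (_ : 16 * x + (4 * s2 + 1) - 1 = 16 * x + 4 * s2) ?(negbTE H2) //; lia.
pose b x := \sum_(j < 16) (S (16 * x + j) : nat).
pose v x := S (16 * x + 0) + S (16 * x + 1) + S (16 * x + 2) + S (16 * x + 3).
pose d x := S (16 * x + 4) + S (16 * x + 5) + S (16 * x + 8) + S (16 * x + 9) +
  S (16 * x + 12) + S (16 * x + 13).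
pose r x := S (16 * x + 6) + S (16 * x + 7) + S (16 * x + 10) + S (16 * x + 11) +
  S (16 * x + 14) + S (16 * x + 15).
have bE x : b x = v x + d x + r x := sum16 (fun j => S (16 * x + j)).
have Hv x : x < nblocks -> 0 < v x.
  by move/Hvar; rewrite /v; do 4!case: (S _).
have Hd x : x < nblocks -> 1 < d x.
  by move=> lx; apply: (two_of_three (Hcl x 1 2 lx _ _ _) (Hcl x 1 3 lx _ _ _) (Hcl x 2 3 lx _ _ _)).
have Hb x : x < nblocks -> [/\ v x = 1, d x = 2 & r x = 0].
  move=> lx; have : b x = 3.
    move: x lx; apply: sum_eq_const; last by rewrite -(sum_blocks (fun y => S y)).
    by move=> x lx; rewrite bE; have := Hv x lx; have := Hd x lx; lia.
  by rewrite bE; have := Hv x lx; have := Hd x lx; split; lia.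
exists (fun i => S (16 * i + 1)) => x lx px.
(* Since [d x = 2], the three selectors are not all in S. *)
have : exists2 s, 0 < s < 4 &
    [&& ~~ S (16 * x + 4 * s), ~~ S (16 * x + (4 * s + 2)) & ~~ S (16 * x + (4 * s + 3))].
  have [_ Hdx Hrx] := Hb x lx.
  have Er i : i \in [:: 6; 7; 10; 11; 14; 15] -> S (16 * x + i) = false.
    move=> ii; apply/negP => Si; move: Hrx ii; rewrite /r !inE => Hrx.
    by do 5?[case/orP]; move/eqP => Ei; rewrite Ei in Si; move: Hrx; rewrite Si ?addnS ?addSn.
  case E1: (S (16 * x + 4)); last by exists 1 => //=; rewrite E1 !Er.
  case E2: (S (16 * x + 8)); last by exists 2 => //=; rewrite E2 !Er.
  case E3: (S (16 * x + 12)); last by exists 3 => //=; rewrite E3 !Er.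
  by move: Hdx; rewrite /d E1 E2 E3; do 3!case: (S _).
case=> s hs /and3P[H0 H2 H3]; exists s => //.
have lu : 16 * x + (4 * s + 3) < nmain by apply: vertex_lt => //; lia.
have [np nX] := nmain_gt0 lu.
have [t [_ St]] : separates S (16 * x + (4 * s + 2)) (16 * x + (4 * s + 3)).
  by apply: Hsep => //; [lia|lia|exact: rep_pair].
rewrite adj_y_2 ?adj_y_3; [|lia|lia|lia|lia].
have -> : (16 * x + (4 * s + 2)) %/ 16 = x by lia.
have -> : (16 * x + (4 * s + 2)) %% 16 %/ 4 = s by lia.
have := digit_lt x s np; move: (digit x s) => l ll.
case: (t =P lit_vertex l) => [Et _|_]; last first.
  case: (t =P _) => // Et; move: St; rewrite Et (_ : 16 * x + (4 * s + 3) - 3 = 16 * x + 4 * s) ?(negbTE H0) //.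
  by lia.
have lx' : l %/ 2 < nblocks by lia.
have [Hv1 _ _] := Hb _ lx'; move: St Hv1; rewrite Et /lit_vertex /v.
have [E|E] : l %% 2 = 0 \/ l %% 2 = 1 by lia.
  have -> : odd l = false by lia.
  by rewrite E => ->; case: (S (_ + 1)).
have -> : odd l by lia.
by rewrite E => ->.
Qed.

Lemma div_mod16 x i : i < 16 -> (16 * x + i) %/ 16 = x /\ (16 * x + i) %% 16 = i.
Proof. by lia. Qed.

(** S takes the true literals and, in each block, the selectors other than that of a chosen literal.
    Pairs are separated even when they meet S, because a test cover has to separate all items. *)
Lemma coded_sat_complete : coded_sat ->
  exists2 S : pred nat, \sum_(y < nmain) S y = 3 * nblocks &
    forall y z, y < nmain -> z < nmain -> y != z -> rep y = rep z -> separates S y z.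
Proof.
case=> f Hf.
pose good x s := f (digit x s %/ 2) == odd (digit x s).
(* The omitted selector belongs to a true literal if there is one; the default 3 is harmless for an
   absent clause, whose pairs have distinct codes. *)
pose ch x := if good x 1 then 1 else if good x 2 then 2 else 3.
have Hch x : x < nblocks -> pr x -> good x (ch x).
  move=> lx px; have [s hs Es] := Hf x lx px; rewrite /ch.
  case: ifP => // N1; case: ifP => // N2.
  have [E|[E|E]] : s = 1 \/ s = 2 \/ s = 3 by lia.
  - by rewrite E in Es; move: N1; rewrite /good Es eqxx.
  - by rewrite E in Es; move: N2; rewrite /good Es eqxx.
  by rewrite E in Es; rewrite /good Es eqxx.
have ch_lt x : 0 < ch x < 4 by rewrite /ch; repeat case: ifP.
pose S y := let x := y %/ 16 in let i := y %% 16 in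
  [|| (i == 0) && ~~ f x, (i == 1) && f x | [&& 4 <= i, i %% 4 == 0 & i %/ 4 != ch x]].
have SE x i : i < 16 -> S (16 * x + i) =
    [|| (i == 0) && ~~ f x, (i == 1) && f x | [&& 4 <= i, i %% 4 == 0 & i %/ 4 != ch x]].
  by move=> li; rewrite /S; have [-> ->] := div_mod16 x li.
clearbody S ch; exists S.
  rewrite (sum_blocks (fun y => S y : nat)).
  rewrite (eq_bigr (fun _ => 3)) ?sum_nat_const ?card_ord ?[_ * 3]mulnC //.
  move=> x _; rewrite (sum16 (fun j => S (16 * x + j) : nat)) !SE //=.
  by have := ch_lt x; move: (ch x) => [|[|[|[|]]]] // _; case: (f x).
suff H y z : y < nmain -> z < nmain -> y < z -> rep y = rep z -> separates S y z.
  move=> y z ly lz; rewrite neq_ltn => /orP[] lt E; first exact: H.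
  by have [t [H1 H2 H3]] := H z y lz ly lt (esym E); exists t; rewrite eq_sym.
move=> ly lz lyz E; pose x := y %/ 16; have [np nX] := nmain_gt0 ly.
have lx : x < nblocks by move: ly; rewrite /x /nmain; lia.
case: (rep_class lyz E) => [[H1 Ez]|[Hy Hz Hy4 Hz4 Eyz]|[Hy Hy4 Ez py]].
- exists (16 * x + f x); split.
  + by rewrite /nmain; case: (f x); lia.
  + by rewrite SE; case: (f x).
  rewrite adj_a // adj_a'; last by lia.
  have -> : y = 16 * x + 2 by rewrite /x; lia.
  by case: (f x); lia.
- case Sy: (S (y - 1)).
    exists (y - 1); split=> //; first by lia.
    by rewrite !adj_y_1 //; lia.
  exists (z - 1); split=> //; first by lia.
  + have Ey : y - 1 = 16 * x + (y %% 16 - 1) by rewrite /x; lia.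
    have Ez : z - 1 = 16 * x + (z %% 16 - 1) by rewrite /x; lia.
    by move: Sy; rewrite Ey Ez !SE; try lia; have := ch_lt x; lia.
  by rewrite !adj_y_1 //; lia.
case Sy: (S (y - 2)).
  exists (y - 2); split=> //; first by lia.
  rewrite adj_y_2 // adj_y_3; try lia.
  by rewrite Ez /lit_vertex; lia.
have Es : y %% 16 %/ 4 = ch x.
  have Ey : y - 2 = 16 * x + (y %% 16 - 2) by rewrite /x; lia.
  by move: Sy; rewrite Ey !SE; try lia; have := ch_lt x; lia.
exists (lit_vertex (digit x (ch x))); split.
- exact: lit_vertex_lt (digit_lt _ _ _).
- have := Hch x lx py; rewrite /good /lit_vertex; move: (digit _ _) => l /eqP El.
  rewrite SE; last by lia.
  by rewrite El; lia.
rewrite adj_y_2 // adj_y_3; try lia.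
by rewrite -/x Es eqxx /lit_vertex Ez; lia.
Qed.
End Gadget.

(** * Treewidth of a forest plus a set of hubs *)

Section ParentTree.
Variables (m : nat) (up : 'I_m.+1 -> 'I_m.+1) (rk : 'I_m.+1 -> nat).
Hypothesis rk_up : forall x, x != ord0 -> rk (up x) < rk x.

Definition tree_edge (x y : 'I_m.+1) : bool :=
  (x != ord0) && (up x == y) || (y != ord0) && (up y == x).

Lemma tree_edge_sym : symmetric tree_edge.
Proof. by move=> x y; rewrite /tree_edge orbC. Qed.

Lemma tree_edge_up x : x != ord0 -> tree_edge x (up x).
Proof. by move=> x0; rewrite /tree_edge x0 eqxx. Qed.

Lemma tree_edge_is_tree : is_tree tree_edge.
Proof.
have irr : irreflexive tree_edge.
  move=> x; rewrite /tree_edge orbb; apply/negP => /andP[x0 /eqP E].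
  by have := rk_up x0; rewrite E ltnn.
have conn x : connect [rel a b | tree_edge a b] x ord0.
  move: {2}(rk x).+1 (ltnSn (rk x)) => r; elim: r x => [//|r IH] x; rewrite ltnS => lr.
  have [->|x0] := eqVneq x ord0; first exact: connect0.
  apply: (connect_trans (connect1 (tree_edge_up x0 : [rel a b | tree_edge a b] x (up x)))).
  by apply: IH; apply: leq_trans (rk_up x0) lr.
have csym : connect_sym [rel a b | tree_edge a b].
  by apply: sym_connect_sym => x y /=; apply: tree_edge_sym.
split; first exact: tree_edge_sym.
split; first exact: irr.
split; first by move=> x y; apply: connect_trans (conn x) _; rewrite csym.
(* Every node but the root gives one edge, counted as two ordered pairs; the two families are
   disjoint because [rk] drops along [up]. *)
pose A := [set (x, up x) | x in [set~ (ord0 : 'I_m.+1)]].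
pose B := [set (up x, x) | x in [set~ (ord0 : 'I_m.+1)]].
have cA : #|A| = m by rewrite card_imset ?cardsC1 ?card_ord // => x y [].
have cB : #|B| = m by rewrite card_imset ?cardsC1 ?card_ord // => x y [].
have -> : [set p : 'I_m.+1 * 'I_m.+1 | tree_edge p.1 p.2] = A :|: B.
  apply/setP => [[x y]]; rewrite !inE /tree_edge /=; apply/idP/idP.
    case/orP => /andP[x0 /eqP E]; apply/orP; [left|right].
      by apply/imsetP; exists x; rewrite ?inE // E.
    by apply/imsetP; exists y; rewrite ?inE // E.
  by case/orP => /imsetP[z]; rewrite !inE => z0 [-> ->]; rewrite z0 eqxx ?orbT.
rewrite cardsU cA cB (_ : A :&: B = set0) ?cards0; first by lia.
apply/setP => [[x y]]; rewrite !inE; apply/negP => /andP[/imsetP[z z0 [-> ->]] /imsetP[w w0 [E1 E2]]].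
rewrite !inE in z0 w0.
by have := rk_up z0; have := rk_up w0; rewrite -E1 E2; lia.
Qed.
End ParentTree.

(** The node of [v] carries [H], [v] and [par v]; one extra node with bag [H] joins the trees of the
    forest. *)
Lemma tw_le_forest (G : graph) (H : {set 'I_(gn G)}) (par : 'I_(gn G) -> 'I_(gn G))
    (rk : 'I_(gn G) -> nat) :
  (forall v, par v != v -> rk (par v) < rk v) ->
  (forall u v, @gadj G u v -> [|| u \in H, v \in H, par u == v | par v == u]) ->
  tw_le G #|H|.+1.
Proof.
move=> Hrk Hadj; set m := gn G.
pose up (k : 'I_m.+1) : 'I_m.+1 :=
  if unlift ord0 k is Some v then (if par v == v then ord0 else lift ord0 (par v)) else ord0.
pose rk' (k : 'I_m.+1) := if unlift ord0 k is Some v then (rk v).+1 else 0.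
pose bag (k : 'I_m.+1) : {set 'I_m} :=
  if unlift ord0 k is Some v then H :|: [set v; par v] else H.
have bagE v : bag (lift ord0 v) = H :|: [set v; par v] by rewrite /bag liftK.
have HH k : H \subset bag k by rewrite /bag; case: unlift => [v|]; rewrite ?subsetUl.
have rk_up k : k != ord0 -> rk' (up k) < rk' k.
  case: (unliftP ord0 k) => [v ->|->]; last by rewrite eqxx.
  rewrite /rk' /up !liftK => _; case: ifP => Hv; first by rewrite unlift_none.
  by rewrite liftK ltnS Hrk ?Hv.
have tree := tree_edge_is_tree rk_up.
exists m, (tree_edge up), bag; split=> //.
- by move=> v; exists (lift ord0 v); rewrite bagE !inE eqxx orbT.
- move=> u v /Hadj /or4P[Hu|Hv|/eqP E|/eqP E].
  + by exists (lift ord0 v); rewrite bagE !inE Hu eqxx orbT.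
  + by exists (lift ord0 u); rewrite bagE !inE Hv eqxx orbT.
  + by exists (lift ord0 u); rewrite bagE !inE E !eqxx !orbT.
  by exists (lift ord0 v); rewrite bagE !inE E !eqxx !orbT.
- move=> v x y Hx Hy.
  have [vH|vH] := boolP (v \in H).
    have [_ [_ [conn _]]] := tree; have := conn x y.
    rewrite (@eq_connect _ _ [rel a b | [&& tree_edge up a b, v \in bag a & v \in bag b]]) //.
    by move=> a b /=; rewrite !(subsetP (HH _)) // !andbT.
  pose R := [rel a b | [&& tree_edge up a b, v \in bag a & v \in bag b]].
  have csym : connect_sym R.
    by apply: sym_connect_sym => a b /=; rewrite tree_edge_sym [X in _ && X]andbC.
  (* Outside [H], the bags containing [v] are its own and those of its children, a star around the
     node of [v]. *)
  have key z : v \in bag z -> connect R z (lift ord0 v).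
    move=> Hz; move: (Hz); rewrite {1}/bag; case: unliftP => [w Ez|_]; last by rewrite (negbTE vH).
    rewrite !inE (negbTE vH) /= => /orP[/eqP ->|/eqP Ew]; first by rewrite -Ez.
    have [Epw|Npw] := eqVneq (par w) w; first by rewrite Ew Epw -Ez.
    apply: connect1; rewrite /= Hz bagE !inE eqxx orbT !andbT.
    have -> : lift ord0 v = up z by rewrite /up Ez liftK (negbTE Npw) Ew.
    by apply: tree_edge_up; rewrite Ez eq_sym neq_lift.
  by apply: connect_trans (key x Hx) _; rewrite csym; apply: key.
move=> k; rewrite /bag; case: unlift => [v|]; last by apply: leqW; apply: leqW.
apply: (@leq_trans (#|H| + #|[set v; par v]|)); first exact: leq_card_setU.
by rewrite cards2 -addn2 leq_add2l; case: (_ != _).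
Qed.

(** * Satisfiability in terms of clause codes *)

Lemma digit_code n l1 l2 l3 : l1 < 2 * n -> l2 < 2 * n -> l3 < 2 * n ->
  [/\ digit n (code n l1 l2 l3) 1 = l1, digit n (code n l1 l2 l3) 2 = l2
    & digit n (code n l1 l2 l3) 3 = l3].
Proof.
rewrite /digit /code /=; move: (2 * n) => m h1 h2 h3; have mp : 0 < m by lia.
split; last by rewrite modnMDl modn_small.
  by rewrite divnMA divnMDl // (divn_small h3) addn0 divnMDl // (divn_small h2) addn0 modn_small.
by rewrite divnMDl // (divn_small h3) addn0 modnMDl modn_small.
Qed.

Lemma code_lt n l1 l2 l3 : l1 < 2 * n -> l2 < 2 * n -> l3 < 2 * n ->
  code n l1 l2 l3 < nblocks n.
Proof. by rewrite /code /nblocks; move: (2 * n) => m h1 h2 h3; nia. Qed.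

Lemma lit_natP (phi : cnf3) (l : 'I_(nvars phi) * bool) :
  [/\ lit_nat l < 2 * nvars phi, odd (lit_nat l) = l.2 & lit_nat l %/ 2 = l.1].
Proof.
case: l => [[i li] b]; rewrite /lit_nat /=; move: (nvars phi) li => n li.
by case: b; split; lia.
Qed.

Lemma coded_satP (phi : cnf3) :
  coded_sat (nvars phi) (present (enc_cnf3 phi)) <-> satisfiable3 phi.
Proof.
set n := nvars phi.
have Hl (l : 'I_n * bool) : lit_nat l < 2 * n by have [] := lit_natP l.
have Hodd (l : 'I_n * bool) : odd (lit_nat l) = l.2 by have [] := lit_natP l.
have Hhalf (l : 'I_n * bool) : lit_nat l %/ 2 = l.1 by have [] := lit_natP l.
split=> [[f Hf]|[f Hf]].
  exists (fun i => f i); apply/allP => c cin.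
  have [D1 D2 D3] := digit_code (Hl c.1.1) (Hl c.1.2) (Hl c.2).
  have [||s hs] := Hf (clause_code c).
  - exact: code_lt.
  - by apply/presentP; exists c.
  have [Es|[Es|Es]] : s = 1 \/ s = 2 \/ s = 3 by lia.
  - by rewrite Es /clause_code D1 Hodd Hhalf /lit_true => ->; rewrite eqxx.
  - by rewrite Es /clause_code D2 Hodd Hhalf /lit_true => ->; rewrite eqxx orbT.
  - by rewrite Es /clause_code D3 Hodd Hhalf /lit_true => ->; rewrite eqxx !orbT.
exists (fun k => if insub k is Some i then f i else false) => x lx /presentP[c cin <-].
have [D1 D2 D3] := digit_code (Hl c.1.1) (Hl c.1.2) (Hl c.2).
have := allP Hf c cin => /or3P[] /eqP E.
- by exists 1 => //; rewrite /clause_code D1 Hodd Hhalf valK.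
- by exists 2 => //; rewrite /clause_code D2 Hodd Hhalf valK.
- by exists 3 => //; rewrite /clause_code D3 Hodd Hhalf valK.
Qed.

(** * Hubs *)

(** The binary length of [(nmain n).+1], written as a bounded sum over shifts so that the closure
    properties of [comp] apply. *)
Definition nbits (n : nat) : nat := \sum_(i < (nmain n).+1) (0 < (nmain n).+1 %/ 2 ^ i : nat).
Definition nhubs (n : nat) : nat := (nbits n).+2.

Lemma nbitsE n : nbits n = (trunc_log 2 (nmain n).+1).+1.
Proof.
rewrite /nbits (eq_bigr (fun i : 'I__ => i < (trunc_log 2 (nmain n).+1).+1 : nat)).
  rewrite sum_lt_ord; apply/minn_idPr.
  have := trunc_logP (isT : 1 < 2) (ltn0Sn (nmain n)).
  have := ltn_expl (trunc_log 2 (nmain n).+1) (isT : 1 < 2).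
  by lia.
move=> i _; congr nat_of_bool; rewrite divn_gt0 ?expn_gt0 //.
rewrite ltnS; apply/idP/idP => [|le]; first exact: trunc_log_max.
by apply: leq_trans (leq_pexp2l _ le) (trunc_logP _ _).
Qed.

Lemma nbits_lb n : nmain n < 2 ^ nbits n.
Proof. by rewrite nbitsE; apply: ltnW; apply: trunc_log_ltn. Qed.

Lemma nbits_ub n : 2 ^ nbits n <= 2 * (nmain n).+1.
Proof. by rewrite nbitsE expnS leq_mul2l trunc_logP. Qed.

Lemma bits_inj k a b : a < 2 ^ k -> b < 2 ^ k ->
  (forall i, i < k -> odd (a %/ 2 ^ i) = odd (b %/ 2 ^ i)) -> a = b.
Proof.
elim: k a b => [|k IH] a b; first by rewrite expn0; case: a; case: b.
rewrite expnS => la lb H.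
have E0 := H 0 isT; rewrite !divn1 in E0.
suff : a %/ 2 = b %/ 2 by lia.
apply: IH; [lia|lia|] => i li.
by have := H i.+1 li; rewrite expnS !divnMA.
Qed.

Lemma sum_split4 (F : nat -> nat) a b c d : \sum_(i < a + (b + (c + d))) F i =
  \sum_(i < a) F i + (\sum_(i < b) F (a + i) +
    (\sum_(i < c) F (a + (b + i)) + \sum_(i < d) F (a + (b + (c + i))))).
Proof. by rewrite !big_split_ord. Qed.

Lemma sum_split2 (F : nat -> nat) a b : \sum_(i < a + b) F i =
  \sum_(i < a) F i + \sum_(i < b) F (a + i).
Proof. by rewrite big_split_ord. Qed.

Section Instances.
Variables (n : nat) (pr : pred nat).

Notation Y := (nmain n).
Notation p := (nhubs n).
Notation rep := (rep pr).
Notation madj := (adj n).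

(* The first two hubs see every main vertex, so that no main vertex looks like
   the private neighbour of a single hub. *)
Definition hub (b y : nat) : bool := (b < 2) || odd (rep y %/ 2 ^ (b - 2)).

Lemma hub_rep b y z : rep y = rep z -> hub b y = hub b z.
Proof. by rewrite /hub => ->. Qed.

Lemma hub_inj y z : y < Y -> z < Y -> rep y <> rep z -> exists2 b, b < p & hub b y != hub b z.
Proof.
move=> ly lz ne; case: (pickP (fun b : 'I_p => hub b y != hub b z)) => [b Hb|Hb].
  by exists b.
case: ne; apply: (@bits_inj (nbits n)).
- exact: leq_ltn_trans (ltnW (rep_lt pr ly)) (nbits_lb n).
- exact: leq_ltn_trans (ltnW (rep_lt pr lz)) (nbits_lb n).
move=> i li; have lt : i.+2 < p by rewrite /nhubs !ltnS.
by have /negbFE/eqP := Hb (Ordinal lt); rewrite /hub /= subn2.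
Qed.

Definition in_set N (S : {set 'I_N}) (y : nat) : bool :=
  if insub y is Some i then i \in S else false.

Lemma in_setE N (S : {set 'I_N}) (i : 'I_N) : in_set S i = (i \in S).
Proof. by rewrite /in_set valK. Qed.

Lemma in_setP N (S : {set 'I_N}) y (ly : y < N) : in_set S y = (Ordinal ly \in S).
Proof. by rewrite -in_setE. Qed.

Lemma card_in_set N (S : {set 'I_N}) : #|S| = \sum_(y < N) in_set S y.
Proof.
by rewrite -sum1_card big_mkcond; apply: eq_bigr => i _; rewrite in_setE; case: (i \in S).
Qed.

(** ** Locating-dominating set *)

(** Each hub [z] has two pendants, z + p and z + 2 p, with [z] as sole neighbour. A
    locating-dominating set contains at least two of these three vertices, and the hub with one
    pendant is such a choice. *)
Definition lds_dir (y z : nat) : bool :=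
  if y < Y then (if z < Y then madj y z else (z < Y + p) && hub (z - Y) y)
  else [&& Y + p <= y, Y <= z, z < Y + p & (y == z + p) || (y == z + (p + p))].

Definition lds_adj (y z : nat) : bool := lds_dir y z || lds_dir z y.

Definition lds_size : nat := Y + (p + (p + p)).
Definition lds_budget : nat := 3 * nblocks n + (p + p).

Definition lds_graph : graph := Graph (fun i j : 'I_lds_size => lds_adj i j).

Definition lds_of : lds_inst := LdsInst lds_graph lds_budget.

Lemma lds_simple : simple_graph lds_graph.
Proof.
split=> [i j|i]; first by rewrite /= /lds_adj orbC.
rewrite /= /lds_adj orbb /lds_dir; case: (i < Y); first by rewrite /adj eqxx.
by apply/negP => /and4P[? _ ?]; lia.
Qed.

Lemma lds_adj_main y z : y < Y -> z < Y -> lds_adj y z = madj y z.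
Proof. by move=> ly lz; rewrite /lds_adj /lds_dir ly lz [madj z y]adjC orbb. Qed.

Lemma lds_adj_hub y b : y < Y -> b < p -> lds_adj y (Y + b) = hub b y.
Proof.
move=> ly lb; rewrite /lds_adj /lds_dir ly.
have -> : (Y + b < Y) = false by lia.
have -> : Y + b < Y + p by lia.
have -> : (Y + p <= Y + b) = false by lia.
by rewrite orbF addKn.
Qed.

Lemma lds_adj_pendant y w : y < lds_size -> Y + p <= w -> w < lds_size ->
  lds_adj y w = (Y <= y < Y + p) && ((w == y + p) || (w == y + (p + p))).
Proof.
rewrite /lds_size => ly lw lw'; rewrite /lds_adj /lds_dir.
have -> : (w < Y) = false by lia.
have -> : (w < Y + p) = false by lia.
rewrite lw /=; case: ltnP => Hy; first by case: (leqP Y y) => //; lia.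
by rewrite !andbF /=.
Qed.

Lemma lds_adjC y z : lds_adj y z = lds_adj z y.
Proof. by rewrite /lds_adj orbC. Qed.

Lemma lds_adj_pendant' w b : w < lds_size -> b < p ->
  lds_adj (Y + (p + b)) w = (w == Y + b) /\ lds_adj (Y + (p + (p + b))) w = (w == Y + b).
Proof.
move=> lw lb; rewrite ![lds_adj (_ + _) w]lds_adjC !lds_adj_pendant //; rewrite /lds_size in lw *; lia.
Qed.

Lemma lds_sound : lds_yes lds_of -> coded_sat n pr.
Proof.
case=> S [] /=; rewrite card_in_set => Hk [Hdom Hloc].
have Hdom' y : y < lds_size -> ~~ in_set S y -> exists2 u, u < lds_size & in_set S u && lds_adj y u.
  move=> ly; rewrite (in_setP S ly) => /Hdom [u uS uy]; exists (val u); first exact: ltn_ord.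
  by rewrite in_setE uS.
have Hloc' y z : y < lds_size -> z < lds_size -> ~~ in_set S y -> ~~ in_set S z -> y != z ->
    exists2 u, u < lds_size & in_set S u && (lds_adj y u != lds_adj z u).
  move=> ly lz; rewrite (in_setP S ly) (in_setP S lz) => Sy Sz ne.
  have := Hloc _ _ Sy Sz ne; case: (pickP (fun u : 'I_lds_size => (u \in S) && (lds_adj y u != lds_adj z u))).
    by move=> u Hu _; exists (val u); [apply: ltn_ord | rewrite in_setE].
  move=> H /eqP[]; apply/setP => w; rewrite !inE.
  by have := H w; case: (w \in S) => //= /negbFE/eqP.
move: (in_set S) Hk Hdom' Hloc' => {Hdom Hloc}T Hk Hdom Hloc.
apply: (@coded_sat_sound n pr T).
  move=> y z ly lz ne E Ty Tz.
  have ly' : y < lds_size by rewrite /lds_size; lia.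
  have lz' : z < lds_size by rewrite /lds_size; lia.
  have [u lu /andP[Tu]] := Hloc y z ly' lz' Ty Tz ne.
  case: (ltnP u Y) => [luY|leu].
    by rewrite !lds_adj_main // => Hu; exists u; split=> //; rewrite ![madj u _]adjC.
  case: (ltnP u (Y + p)) => [luY|leu'].
    have -> : u = Y + (u - Y) by lia.
    by rewrite !lds_adj_hub ?(hub_rep _ E) ?eqxx //; lia.
  rewrite !lds_adj_pendant //.
  by rewrite !(leqNgt Y) ly lz.
(* The two pendants are twins, so one of them is in the set; if the other is not, its domination
   requires the hub. *)
have Hpend b : b < p -> 1 < T (Y + b) + T (Y + (p + b)) + T (Y + (p + (p + b))).
  move=> lb.
  have l1 : Y + (p + b) < lds_size by rewrite /lds_size; lia.
  have l2 : Y + (p + (p + b)) < lds_size by rewrite /lds_size; lia.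
  case T1: (T (Y + (p + b))); case T2: (T (Y + (p + (p + b)))).
  - by case: (T _).
  - have [u lu /andP[Tu]] := Hdom _ l2 (negbT T2).
    by have [_ ->] := lds_adj_pendant' lu lb; move/eqP => Eu; rewrite -Eu Tu.
  - have [u lu /andP[Tu]] := Hdom _ l1 (negbT T1).
    by have [-> _] := lds_adj_pendant' lu lb; move/eqP => Eu; rewrite -Eu Tu.
  have ne : Y + (p + b) != Y + (p + (p + b)) by rewrite !eqn_add2l /nhubs; lia.
  have [u lu /andP[_]] := Hloc _ _ l1 l2 (negbT T1) (negbT T2) ne.
  by have [-> ->] := lds_adj_pendant' lu lb; rewrite eqxx.
move: Hk; rewrite /lds_size (sum_split4 (fun y => T y)).
have := @sum_ge_const (fun b => T (Y + b) + T (Y + (p + b)) + T (Y + (p + (p + b)))) 2 p Hpend.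
rewrite !big_split /= /lds_budget.
rewrite mul2n -addnn -addnA => H1 H2.
by have := leq_trans (leq_add (leqnn _) H1) H2; rewrite leq_add2r.
Qed.

Lemma lds_complete : coded_sat n pr -> lds_yes lds_of.
Proof.
case/coded_sat_complete => T Hsum Hsep.
(* All hubs are added, and the first pendant of each. *)
pose T' y := if y < Y then T y else y < Y + (p + p).
pose S := [set i : 'I_lds_size | T' i].
have Hin y : y < lds_size -> in_set S y = T' y.
  by move=> ly; rewrite (in_setP S ly) inE.
have Thub b : b < p -> T' (Y + b).
  by move=> lb; rewrite /T' (_ : (Y + b < Y) = false); lia.
have p2 : 1 < p by [].
exists S; split.
  rewrite card_in_set (eq_bigr (fun i : 'I__ => T' i : nat)); last by move=> i _; rewrite Hin.
  rewrite /lds_size (sum_split4 (fun y => T' y)).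
  have -> : \sum_(i < Y) (T' i : nat) = 3 * nblocks n.
    by rewrite -Hsum; apply: eq_bigr => i _; rewrite /T' ltn_ord.
  rewrite leq_add2l addnA.
  have -> : \sum_(i < p) (T' (Y + (p + (p + i))) : nat) = 0.
    apply: big1 => i _; rewrite /T' ltnNge leq_addr /= ltn_add2l ltn_add2l.
    by rewrite ltnNge leq_addr.
  rewrite addn0; apply: (@leq_trans (\sum_(i < p) 1 + \sum_(i < p) 1)).
    by apply: leq_add; apply: leq_sum => i _; case: (T' _).
  by rewrite !sum_nat_const !card_ord !muln1.
have wit (u v : 'I_lds_size) w : w < lds_size -> T' w -> lds_adj u w != lds_adj v w ->
    [set w in S | @gadj lds_graph u w] != [set w in S | @gadj lds_graph v w].
  move=> lw Tw; apply: contraNneq => E; have := congr1 (fun A : {set 'I_lds_size} => Ordinal lw \in A) E.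
  by rewrite !inE /= Tw /= => ->.
have pend (v : 'I_lds_size) : v \notin S -> Y <= v -> exists2 b, b < p & v = Y + (p + (p + b)) :> nat.
  rewrite inE /T' => Hv leY; exists (v - Y - p - p); have := ltn_ord v; rewrite {2}/lds_size;
  move: Hv; case: ifP => [|_]; lia.
split=> [v vS|u v uS vS ne].
  case: (ltnP v Y) => Hv.
    have l0 : Y + 0 < lds_size by rewrite /lds_size; lia.
    exists (Ordinal l0); first by rewrite inE; apply: Thub.
    by rewrite /= lds_adj_hub.
  have [b lb Ev] := pend v vS Hv.
  have lb' : Y + b < lds_size by rewrite /lds_size; lia.
  exists (Ordinal lb'); first by rewrite inE; apply: Thub.
  by rewrite /= Ev; have [_ ->] := lds_adj_pendant' lb' lb.
have hubl b : b < p -> Y + b < lds_size by rewrite /lds_size; lia.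
have mixed (a c : 'I_lds_size) : a \notin S -> c \notin S -> a < Y -> Y <= c ->
    exists w, [/\ w < lds_size, T' w & lds_adj a w != lds_adj c w].
  move=> aS cS la lc; have [b lb Ec] := pend c cS lc.
  (* One of the hubs 0 and 1 is not the neighbour of the pendant [c], while both see the main
     vertex. *)
  pose b' := (b == 0 : nat); have lb' : b' < p by rewrite /b'; case: (b == 0).
  exists (Y + b'); split; [exact: hubl|exact: Thub|].
  have [_] := lds_adj_pendant' (hubl b' lb') lb; rewrite Ec => ->.
  rewrite lds_adj_hub // /hub /b' eqn_add2l; by case: (b) => [|[|]].
case: (ltnP u Y) => Hu; case: (ltnP v Y) => Hv.
- case: (rep u =P rep v) => [E|E].
    have [t [lt Tt Ht]] := Hsep u v Hu Hv ne E.
    apply: (wit u v t); rewrite ?/T' ?lt //; first by rewrite /lds_size; lia.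
    by rewrite !lds_adj_main // ![madj _ t]adjC.
  have [b lb Hb] := hub_inj Hu Hv E.
  by apply: (wit u v (Y + b)); [exact: hubl|exact: Thub|rewrite !lds_adj_hub].
- by have [w [lw Tw Hw]] := mixed u v uS vS Hu Hv; apply: wit lw Tw Hw.
- by have [w [lw Tw Hw]] := mixed v u vS uS Hv Hu; apply: (wit u v w) => //; rewrite eq_sym.
have [b lb Eu] := pend u uS Hu; have [c lc Ev] := pend v vS Hv.
apply: (wit u v (Y + b)); [exact: hubl|exact: Thub|].
have [_] := lds_adj_pendant' (hubl b lb) lb; rewrite Eu => ->.
have [_] := lds_adj_pendant' (hubl b lb) lc; rewrite Ev => ->.
rewrite eqxx eqn_add2l; apply: contraNneq ne => /esym/eqP Ebc; apply/eqP/val_inj.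
by rewrite /= Eu Ev Ebc.
Qed.

Lemma lds_tw : tw_le lds_graph p.+1.
Proof.
pose H := [set i : 'I_lds_size | Y <= i < Y + p].
have cH : #|H| = p.
  rewrite card_in_set (eq_bigr (fun i : 'I_lds_size => Y <= i < Y + p : nat)); last first.
    by move=> i _; rewrite in_setE inE.
  rewrite /lds_size (sum_split4 (fun y => Y <= y < Y + p : nat)) big1 ?add0n; last by move=> i _; have := ltn_ord i; lia.
  rewrite [X in _ + (_ + X)]big1 ?addn0; last by move=> i _; lia.
  rewrite [X in _ + X]big1 ?addn0; last by move=> i _; lia.
  rewrite (eq_bigr (fun _ => 1)) ?sum_nat_const ?card_ord ?muln1 //.
  by move=> i _; have := ltn_ord i; lia.
have par_lt (v : 'I_lds_size) : (if v < Y then parent n v else v) < lds_size.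
  by case: ifP => [/parent_lt|_]; rewrite ?ltn_ord // /lds_size; lia.
rewrite -cH; apply: (@tw_le_forest lds_graph H (fun v => Ordinal (par_lt v)) (fun v => rank v)).
  move=> v; rewrite -val_eqE /=; case: ifP => _; last by rewrite eqxx.
  exact: rank_parent.
have dir (u v : 'I_lds_size) : lds_dir u v ->
    [|| u \in H, v \in H, Ordinal (par_lt u) == v | Ordinal (par_lt v) == u].
  rewrite /lds_dir !inE -!val_eqE /=; case: ifP => lu; last by case/and4P => _ -> ->; rewrite orbT.
  case: ifP => lv; first by case/andP => _ /orP[] ->; rewrite !orbT.
  by case/andP => lv' _; rewrite lv' (leqNgt Y v) lv !orbT.
move=> u v /orP[/dir //|/dir]; by case/or4P => ->; rewrite ?orbT.
Qed.

(** ** Test cover *)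

(** Main vertices are both tests and items. The only item from [Y] on in the test Y + b is Y + b,
    and the item Y + p lies in no test. Separating these two items forces the test Y + b into every
    cover. *)
Definition tc_rel (t u : nat) : bool :=
  if t < Y then (u < Y) && madj t u else if u < Y then hub (t - Y) u else u == t.

Definition tc_of : tc_inst :=
  @TcInst (Y + p).+1 (Y + p) (fun t u => tc_rel t u) (3 * nblocks n + p).

Lemma tc_sound : tc_yes tc_of -> coded_sat n pr.
Proof.
case=> S [] /=; rewrite card_in_set => Hk Hsep.
have Hsep' y z : y <= Y + p -> z <= Y + p -> y != z ->
    exists2 t, t < Y + p & in_set S t && (tc_rel t y != tc_rel t z).
  move=> ly lz ne.
  have [t tS Ht] := Hsep (Ordinal (ly : y < (Y + p).+1)) (Ordinal (lz : z < (Y + p).+1)) ne.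
  by exists (val t); [apply: ltn_ord | rewrite in_setE tS].
move: (in_set S) Hk Hsep' => {Hsep}T Hk Hsep.
have Thub b : b < p -> T (Y + b).
  move=> lb; have [|||t lt /andP[Tt]] := Hsep (Y + b) (Y + p); try lia.
  rewrite /tc_rel; have -> : (Y + b < Y) = false by lia.
  have -> : (Y + p < Y) = false by lia.
  case: ifP => //= _; have -> : (Y + p == t) = false by lia.
  by rewrite eqbF_neg negbK => /eqP ->.
apply: (@coded_sat_sound n pr T).
  move=> y z ly lz ne E _ _.
  have [|||t lt /andP[Tt]] := Hsep y z; try lia.
  rewrite /tc_rel ly lz; case: ifP => [ltY|_] /=; first by exists t.
  by rewrite (hub_rep _ E) eqxx.
move: Hk; rewrite (sum_split2 (fun y => T y)) [X in _ + X](eq_bigr (fun _ => 1)).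
  by rewrite sum_nat_const card_ord muln1 leq_add2r.
by move=> i _; rewrite Thub.
Qed.

Lemma tc_complete : coded_sat n pr -> tc_yes tc_of.
Proof.
case/coded_sat_complete => T Hsum Hsep.
pose T' y := if y < Y then T y else true.
pose S := [set i : 'I_(Y + p) | T' i].
have Thub b : T' (Y + b) by rewrite /T' (_ : (Y + b < Y) = false) //; lia.
exists S; split.
  rewrite card_in_set (eq_bigr (fun i : 'I__ => T' i : nat)); last by move=> i _; rewrite in_setE inE.
  rewrite (sum_split2 (fun y => T' y)).
  have -> : \sum_(i < Y) (T' i : nat) = 3 * nblocks n.
    by rewrite -Hsum; apply: eq_bigr => i _; rewrite /T' ltn_ord.
  rewrite leq_add2l (eq_bigr (fun _ => 1)) ?sum_nat_const ?card_ord ?muln1 //.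
  by move=> i _; rewrite Thub.
suff H (u v : nat) : u <= Y + p -> v <= Y + p -> u < v ->
    exists t, [/\ t < Y + p, T' t & tc_rel t u != tc_rel t v].
  have H' (u v : 'I_(Y + p).+1) : u < v -> exists2 t : 'I_(Y + p), t \in S & tc_rel t u != tc_rel t v.
    move=> luv; have [t [lt Tt Ht]] := H u v (ltn_ord u) (ltn_ord v) luv.
    by exists (Ordinal lt); rewrite ?inE.
  move=> u v; rewrite -val_eqE neq_ltn => /orP[/H' //|/H'[t tS Ht]].
  by exists t => //; rewrite eq_sym.
move=> lu lv luv.
have hubE b w : tc_rel (Y + b) w = if w < Y then hub b w else w == Y + b.
  by rewrite /tc_rel addKn (_ : (Y + b < Y) = false) //; lia.
case: (ltnP u Y) => Hu; case: (ltnP v Y) => Hv.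
- case: (rep u =P rep v) => [E|E].
    have ne : u != v by rewrite neq_ltn luv.
    have [t [lt Tt Ht]] := Hsep u v Hu Hv ne E.
    by exists t; rewrite /T' /tc_rel lt Hu Hv; split=> //; lia.
  have [b lb Hb] := hub_inj Hu Hv E.
  by exists (Y + b); rewrite !hubE Hu Hv; split=> //; lia.
(* The tests Y and Y + 1 both contain the main item [u], and at least one of them misses [v]. *)
- pose b := (v == Y : nat); have lb : b < p by rewrite /b; case: (v == Y).
  exists (Y + b); rewrite !hubE Hu (_ : (v < Y) = false); last by lia.
  split=> //; first by lia.
  by rewrite /hub /b; case: (v =P Y) => [->|]; rewrite /=; lia.
- by lia.
have Hu' : (u < Y) = false by rewrite ltnNge Hu.
have Hv' : (v < Y) = false by rewrite ltnNge Hv.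
exists u; rewrite /tc_rel /T' Hu' Hv' eqxx; split=> //; first by lia.
by rewrite (gtn_eqF luv).
Qed.

(** Without the hub tests, the auxiliary graph is the bipartite double cover of the forest plus
    isolated items. This is again a forest: the parent of a test is the item of its parent, and
    conversely. *)
Lemma tc_tw : tw_le (tc_aux tc_of) p.+1.
Proof.
set F := Y + p; set U := F.+1.
pose H := [set i : 'I_(F + U) | Y <= i < F].
have cH : #|H| = p.
  rewrite card_in_set (eq_bigr (fun i : 'I_(F + U) => Y <= i < F : nat)); last first.
    by move=> i _; rewrite in_setE inE.
  rewrite /F -addnA -[p + U]addn0 -addnA (sum_split4 (fun y => Y <= y < Y + p : nat)) big_ord0 addn0 big1 ?add0n; last by move=> i _; have := ltn_ord i; lia.
  rewrite [X in _ + X]big1 ?addn0; last by move=> i _; lia.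
  rewrite (eq_bigr (fun _ => 1)) ?sum_nat_const ?card_ord ?muln1 //.
  by move=> i _; have := ltn_ord i; lia.
pose par (v : 'I_(F + U)) := if v < Y then (if parent n v == v then (v : nat) else F + parent n v)
   else if F <= v < F + Y then (if parent n (v - F) == v - F then (v : nat) else parent n (v - F)) else v.
pose rk v := if v < Y then rank v else rank (v - F).
have par_lt v : par v < F + U.
  rewrite /par; case: ifP => [/parent_lt lv|_].
    case: ifP => _; first exact: ltn_ord.
    by rewrite ltn_add2l ltnS (leq_trans (ltnW lv)) // leq_addr.
  case: ifP => [lv|_]; last exact: ltn_ord.
  case: ifP => _; first exact: ltn_ord.
  have lv' : v - F < Y by lia.
  by have := parent_lt lv'; rewrite /F; lia.
have Hrk v : par v != v -> rk (par v) < rk v.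
  rewrite /rk /par; case: ifP => lv.
    case: ifP => Ep; first by rewrite eqxx.
    move=> _; have -> : (F + parent n v < Y) = false by rewrite /F; lia.
    by rewrite addKn; apply: rank_parent; rewrite Ep.
  case: ifP => lv'; last by rewrite eqxx.
  case: ifP => Ep; first by rewrite eqxx.
  have lvF : v - F < Y by lia.
  by move=> _; rewrite (parent_lt lvF); apply: rank_parent; rewrite Ep.
rewrite -cH; apply: (@tw_le_forest (tc_aux tc_of) H (fun v => Ordinal (par_lt v)) (fun v => rk v)).
  by move=> v; rewrite -val_eqE; apply: Hrk.
have dir (t : 'I_F) (u : 'I_U) : tc_rel t u ->
    [|| lshift U t \in H, rshift F u \in H, Ordinal (par_lt (lshift U t)) == rshift F u
      | Ordinal (par_lt (rshift F u)) == lshift U t].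
  rewrite !inE -!val_eqE /= /tc_rel; case: ifP => lt; last first.
    by move=> _; rewrite (leqNgt Y t) lt ltn_ord.
  case/andP => lu; rewrite /adj /par /= lt.
  have -> : (F + u < Y) = false by rewrite /F; lia.
  have -> : F <= F + u < F + Y by lia.
  rewrite addKn => /andP[ne /orP[/eqP E|/eqP E]]; rewrite E.
    by rewrite [u == t :> nat]eq_sym (negbTE ne) eqxx !orbT.
  by rewrite (negbTE ne) eqxx !orbT.
move=> x y; rewrite /= /tc_aux /=.
case: (splitP x) => [t Ex|u Ex]; case: (splitP y) => [t' Ey|u' Ey] //.
  have -> : x = lshift U t by apply: val_inj.
  have -> : y = rshift F u' by apply: val_inj.
  exact: dir.
have -> : x = rshift F u by apply: val_inj.
have -> : y = lshift U t' by apply: val_inj.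
by move/dir; case/or4P => ->; rewrite ?orbT.
Qed.
End Instances.

(** * Computing the reductions *)

Lemma comp_odd k (f : ctx k -> nat) : comp f -> comp (fun c => odd (f c) : nat).
Proof.
move=> Hf; apply: (@comp_ext _ (fun c => f c %% 2)); first by move=> c; rewrite modn2.
by apply: comp_mod => //; apply: comp_const.
Qed.

Ltac comp_step := lazymatch goal with
  | |- comp (fun c => @?a c + @?b c) => apply: comp_add
  | |- comp (fun c => @?a c * @?b c) => apply: comp_mul
  | |- comp (fun c => @?a c - @?b c) => apply: comp_sub
  | |- comp (fun c => @?a c %/ 2 ^ @?b c) => apply: comp_shift
  | |- comp (fun c => @?a c %/ @?b c) => apply: comp_div
  | |- comp (fun c => @?a c %% @?b c) => apply: comp_mod
  | |- comp (fun c => nat_of_bool (@?a c && @?b c)) => apply: comp_and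
  | |- comp (fun c => nat_of_bool (@?a c || @?b c)) => apply: comp_or
  | |- comp (fun c => nat_of_bool (~~ @?a c)) => apply: comp_not
  | |- comp (fun c => nat_of_bool (odd (@?a c))) => apply: comp_odd
  | |- comp (fun c => nat_of_bool (@?a c <= @?b c)) => apply: comp_leq
  | |- comp (fun c => nat_of_bool (@?a c == @?b c)) => apply: comp_eq
  | |- comp (fun c => nat_of_bool (if _ then _ else _)) => apply: comp_ifb
  | |- comp (fun c => nat_of_bool (present (inp c) (@?b c))) => apply: comp_present
  | |- comp (fun c => if _ then _ else _) => apply: comp_if
  | |- comp (fun c => nv (inp c)) => apply: comp_nv
  | |- comp (fun c => S (@?a c)) => first [apply: comp_const | apply: comp_succ]
  | |- _ => first [apply: comp_const | apply: comp_var | assumption]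
  end.
Ltac comp_tac := repeat comp_step.

Lemma comp_nblocks k : @comp k (fun c => nblocks (nv (inp c))).
Proof. by rewrite /nblocks; comp_tac. Qed.

Lemma comp_nmain k : @comp k (fun c => nmain (nv (inp c))).
Proof. by rewrite /nmain /nblocks; comp_tac. Qed.

Lemma comp_nhubs k : @comp k (fun c => nhubs (nv (inp c))).
Proof.
rewrite /nhubs /nbits; do 2!apply: comp_succ.
apply: (comp_sum (g := fun c i => 0 < (nmain (nv (inp c))).+1 %/ 2 ^ i : nat)).
  by apply: comp_succ; apply: comp_nmain.
apply: comp_leq; first exact: comp_const.
apply: comp_shift; last exact: comp_var.
by apply: comp_succ; apply: (@comp_nmain k.+1).
Qed.

Section CompGadget.
Variables (k : nat) (f h : ctx k -> nat).
Hypotheses (Hf : comp f) (Hh : comp h).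

Lemma comp_digit : comp (fun c => digit (nv (inp c)) (f c) (h c)).
Proof. by rewrite /digit; comp_tac. Qed.

Lemma comp_lit_vertex : comp (fun c => lit_vertex (f c)).
Proof. by rewrite /lit_vertex; comp_tac. Qed.

Lemma comp_rep : comp (fun c => rep (present (inp c)) (f c)).
Proof. by rewrite /rep; comp_tac. Qed.
End CompGadget.

Lemma comp_parent k (f : ctx k -> nat) : comp f -> comp (fun c => parent (nv (inp c)) (f c)).
Proof.
move=> Hf.
have Hl : comp (fun c => lit_vertex (digit (nv (inp c)) (f c %/ 16) (f c %% 16 %/ 4))).
  by apply: comp_lit_vertex; apply: comp_digit; comp_tac.
by rewrite /parent; comp_tac.
Qed.

Lemma comp_adj k (f h : ctx k -> nat) : comp f -> comp h ->
  comp (fun c => adj (nv (inp c)) (f c) (h c) : nat).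
Proof.
move=> Hf Hh; have Pf := comp_parent Hf; have Ph := comp_parent Hh.
by rewrite /adj; comp_tac.
Qed.

Lemma comp_hub k (f h : ctx k -> nat) : comp f -> comp h ->
  comp (fun c => hub (present (inp c)) (f c) (h c) : nat).
Proof. by move=> Hf Hh; have Rh := comp_rep Hh; rewrite /hub; comp_tac. Qed.

Lemma comp_lds_adj k (f h : ctx k -> nat) : comp f -> comp h ->
  comp (fun c => lds_adj (nv (inp c)) (present (inp c)) (f c) (h c) : nat).
Proof.
have Hm := @comp_nmain k; have Hp := @comp_nhubs k.
have dir (f' h' : ctx k -> nat) : comp f' -> comp h' ->
    comp (fun c => lds_dir (nv (inp c)) (present (inp c)) (f' c) (h' c) : nat).
  move=> Hf Hh; have Ha := comp_adj Hf Hh.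
  have Hb : comp (fun c => hub (present (inp c)) (h' c - nmain (nv (inp c))) (f' c) : nat).
    by apply: comp_hub; comp_tac.
  by rewrite /lds_dir; comp_tac.
by move=> Hf Hh; rewrite /lds_adj; apply: comp_or; apply: dir.
Qed.

Lemma comp_tc_rel k (f h : ctx k -> nat) : comp f -> comp h ->
  comp (fun c => tc_rel (nv (inp c)) (present (inp c)) (f c) (h c) : nat).
Proof.
have Hm := @comp_nmain k; have Hp := @comp_nhubs k.
move=> Hf Hh; have Ha := comp_adj Hf Hh.
have Hb : comp (fun c => hub (present (inp c)) (f c - nmain (nv (inp c))) (h c) : nat).
  by apply: comp_hub; comp_tac.
by rewrite /tc_rel; comp_tac.
Qed.

Lemma mkseq_add T (f : nat -> T) a b : mkseq f (a + b) = mkseq f a ++ mkseq (fun i => f (a + i)) b.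
Proof. by rewrite /mkseq iotaD map_cat add0n -[a in iota a b]addn0 iotaDl -map_comp. Qed.

Lemma eq_in_mkseq T (f g : nat -> T) n : (forall i, i < n -> f i = g i) -> mkseq f n = mkseq g n.
Proof.
by move=> H; apply/eq_in_map => i; rewrite mem_iota => /andP[_ /H].
Qed.

Lemma mkseq_true (f : nat -> bool) n : (forall i, i < n -> f i) -> mkseq f n = nseq n true.
Proof.
elim: n => [//|n IH] H; rewrite mkseqS IH; last by move=> i li; apply: H; lia.
by rewrite H // -cats1 -[[:: true]]/(nseq 1 true) -nseqD addn1.
Qed.

Lemma mkseq_unary (f : nat -> bool) n : (forall i, i < n -> f i) -> f n = false ->
  mkseq f n.+1 = unary n.
Proof. by move=> H E; rewrite mkseqS mkseq_true // E -cats1. Qed.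

Lemma allpairs_mkseq (F : nat -> nat -> bool) N M :
  [seq F (val i) (val j) | i <- enum 'I_N, j <- enum 'I_M] =
  mkseq (fun q => F (q %/ M) (q %% M)) (N * M).
Proof.
have row i : [seq F i (val j) | j <- enum 'I_M] = mkseq (F i) M.
  by rewrite (map_comp (F i) val) val_enum_ord.
have -> : [seq F (val i) (val j) | i <- enum 'I_N, j <- enum 'I_M] =
    flatten [seq mkseq (F i) M | i <- iota 0 N].
  rewrite -val_enum_ord -map_comp; congr flatten; apply: eq_map => i /=; exact: row.
elim: N => [//|N IH].
rewrite -[N.+1]addn1 iotaD map_cat flatten_cat IH mulnDl mul1n mkseq_add /= cats0; congr (_ ++ _).
apply: eq_in_mkseq => j lj.
by rewrite divnMDl ?modnMDl ?divn_small ?modn_small ?addn0 //; lia.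
Qed.

Section Encodings.
Variables (n : nat) (pr : pred nat).

Let N := lds_size n.

Definition lds_len : nat := N.+1 + (N * N + lds_budget n).
Definition lds_bit (i : nat) : bool :=
  if i < N then true else if i == N then false
  else if i < N.+1 + N * N then lds_adj n pr ((i - N.+1) %/ N) ((i - N.+1) %% N) else true.

Lemma enc_lds_mkseq : enc_lds (lds_of n pr) = mkseq lds_bit lds_len.
Proof.
rewrite /enc_lds /enc_graph /lds_len (mkseq_add _ N.+1 (N * N + _)) (mkseq_add _ (N * N)) -catA.
congr (_ ++ (_ ++ _)).
- rewrite mkseq_unary // => [i li|]; first by rewrite /lds_bit li.
  by rewrite /lds_bit ltnn eqxx.
- rewrite (allpairs_mkseq (lds_adj n pr)); apply: eq_in_mkseq => i li; rewrite /lds_bit.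
  have -> : (N.+1 + i < N) = false by lia.
  have -> : (N.+1 + i == N) = false by lia.
  by rewrite ltn_add2l li addKn.
rewrite mkseq_true // => i li; rewrite /lds_bit.
have -> : (N.+1 + (N * N + i) < N) = false by lia.
have -> : (N.+1 + (N * N + i) == N) = false by lia.
by have -> : (N.+1 + (N * N + i) < N.+1 + N * N) = false by lia.
Qed.

Let F := nmain n + nhubs n.
Let U := F.+1.

Definition tc_len : nat := U.+1 + (F.+1 + (F * U + (3 * nblocks n + nhubs n))).
Definition tc_bit (i : nat) : bool :=
  if i < U then true else if i == U then false
  else if i < U.+1 + F then true else if i == U.+1 + F then false
  else if i < U.+1 + (F.+1 + F * U) then
    tc_rel n pr ((i - (U.+1 + F.+1)) %/ U) ((i - (U.+1 + F.+1)) %% U) else true.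

Lemma enc_tc_mkseq : enc_tc (tc_of n pr) = mkseq tc_bit tc_len.
Proof.
rewrite /enc_tc /tc_len (mkseq_add _ U.+1 (F.+1 + _)) (mkseq_add _ F.+1 (F * U + _)).
rewrite (mkseq_add _ (F * U)); congr (_ ++ (_ ++ (_ ++ _))).
- rewrite mkseq_unary // => [i li|]; first by rewrite /tc_bit li.
  by rewrite /tc_bit ltnn eqxx.
- rewrite mkseq_unary // => [i li|]; rewrite /tc_bit.
    rewrite ltn_add2l li.
    have -> : (U.+1 + i < U) = false by lia.
    by have -> : (U.+1 + i == U) = false by lia.
  have -> : (U.+1 + F < U) = false by lia.
  have -> : (U.+1 + F == U) = false by lia.
  by rewrite ltnn eqxx.
- rewrite (allpairs_mkseq (tc_rel n pr)); apply: eq_in_mkseq => i li; rewrite /tc_bit.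
  have -> : (U.+1 + (F.+1 + i) < U) = false by lia.
  have -> : (U.+1 + (F.+1 + i) == U) = false by lia.
  have -> : (U.+1 + (F.+1 + i) < U.+1 + F) = false by lia.
  have -> : (U.+1 + (F.+1 + i) == U.+1 + F) = false by lia.
  by rewrite !ltn_add2l li addnA addKn.
rewrite mkseq_true // => i li; rewrite /tc_bit.
have -> : (U.+1 + (F.+1 + (F * U + i)) < U) = false by lia.
have -> : (U.+1 + (F.+1 + (F * U + i)) == U) = false by lia.
have -> : (U.+1 + (F.+1 + (F * U + i)) < U.+1 + F) = false by lia.
have -> : (U.+1 + (F.+1 + (F * U + i)) == U.+1 + F) = false by lia.
by rewrite !ltn_add2l ltnNge leq_addr.
Qed.
End Encodings.

Lemma comp_lds_len : @comp 0 (fun c => lds_len (nv (inp c))).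
Proof.
have Hb := @comp_nblocks 0; have Hm := @comp_nmain 0; have Hp := @comp_nhubs 0.
by rewrite /lds_len /lds_budget /lds_size; comp_tac.
Qed.

Lemma comp_lds_bit : @comp 1 (fun c => lds_bit (nv (inp c)) (present (inp c)) c.2 : nat).
Proof.
have Hb := @comp_nblocks 1; have Hm := @comp_nmain 1; have Hp := @comp_nhubs 1.
have Hi := comp_var 0.
have HN : @comp 1 (fun c => lds_size (nv (inp c))) by rewrite /lds_size; comp_tac.
have Ha : @comp 1 (fun c => lds_adj (nv (inp c)) (present (inp c))
    ((c.2 - (lds_size (nv (inp c))).+1) %/ lds_size (nv (inp c)))
    ((c.2 - (lds_size (nv (inp c))).+1) %% lds_size (nv (inp c))) : nat).
  by apply: comp_lds_adj; comp_tac.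
by rewrite /lds_bit; comp_tac.
Qed.

Lemma comp_tc_len : @comp 0 (fun c => tc_len (nv (inp c))).
Proof.
have Hb := @comp_nblocks 0; have Hm := @comp_nmain 0; have Hp := @comp_nhubs 0.
by rewrite /tc_len; comp_tac.
Qed.

Lemma comp_tc_bit : @comp 1 (fun c => tc_bit (nv (inp c)) (present (inp c)) c.2 : nat).
Proof.
have Hb := @comp_nblocks 1; have Hm := @comp_nmain 1; have Hp := @comp_nhubs 1.
have Hi := comp_var 0.
pose F (c : ctx 1) := nmain (nv (inp c)) + nhubs (nv (inp c)).
have Ha : @comp 1 (fun c => tc_rel (nv (inp c)) (present (inp c))
    ((c.2 - ((F c).+2 + (F c).+1)) %/ (F c).+1) ((c.2 - ((F c).+2 + (F c).+1)) %% (F c).+1) : nat).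
  by rewrite /F; apply: comp_tc_rel; comp_tac.
by rewrite /tc_bit; comp_tac.
Qed.

(** * Running times *)

(** Provides the treewidth as a number, without which the time bound would say nothing; excluded
    middle stands in for a decision procedure for [tw_le]. *)
Lemma least_nat (P : nat -> Prop) w : P w -> exists t, P t /\ forall v, P v -> t <= v.
Proof.
elim/ltn_ind: w => w IH Pw.
have [[v [lt Pv]]|no] := classic (exists v, v < w /\ P v); first exact: IH lt Pv.
exists w; split=> // v Pv; rewrite leqNgt; apply/negP => lt; apply: no; by exists v.
Qed.

(** A maximum over all possible widths, because the treewidth is only bounded from above and [g]
    need not be monotone. *)
Definition worst (g : nat -> nat) (n : nat) : nat := \max_(w < (nhubs n).+2) 2 ^ g w.

(** Here [w] is at most [nbits n + 3], and [2 ^ nbits n] is at most 2 (128 n^3 + 1). The bound is a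
    cube so that a cube root can be taken below. *)
Lemma nhubs_bound n w : 0 < n -> w < (nhubs n).+2 -> 2 ^ w <= (16 * n) ^ 3.
Proof.
move=> np lw; apply: (@leq_trans (2 ^ (nbits n + 3))).
  by rewrite leq_exp2l //; move: lw; rewrite /nhubs; lia.
rewrite expnD; apply: leq_trans (leq_mul (nbits_ub n) (leqnn _)) _.
by rewrite /nmain /nblocks !expnS expn0; nia.
Qed.

Lemma worst_little_o g : little_o g -> little_o (worst g).
Proof.
(* From 6 g(w) <= w follows (2^g(w))^6 <= 2^w <= (16 n)^3, hence (2^g(w))^2 <= 16 n. *)
move=> Hg e ep; have [N0 HN0] := Hg 6 isT.
pose m0 := \max_(w < N0) 2 ^ g w.
(* The term 16 e^2 gives e^2 (16 n) <= n^2, and [e * m0] covers the finitely many widths below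
   [N0]. *)
exists (1 + 16 * (e * e) + e * m0) => n Hn; have np : 0 < n by lia.
suff H w : w < (nhubs n).+2 -> e * 2 ^ g w <= n.
  rewrite /worst; elim/big_ind: _ => [|a b Ha Hb|i _]; last exact: H.
  - by rewrite muln0.
  - by rewrite maxnMr geq_max Ha.
move=> lw; have [ltw|lew] := ltnP w N0.
  have : 2 ^ g w <= m0 by apply: (leq_bigmax (Ordinal ltw)).
  by move=> le; apply: leq_trans (_ : e * m0 <= n); [rewrite leq_mul2l le orbT | lia].
set a := 2 ^ g w.
have Ha : (a * a) ^ 3 <= (16 * n) ^ 3.
  apply: leq_trans (nhubs_bound np lw); rewrite mulnn -expnM -expnM leq_exp2l //.
  by rewrite mulnC; apply: HN0.
rewrite leq_exp2r // in Ha.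
rewrite -leq_sqr -!mulnn.
have -> : e * a * (e * a) = e * e * (a * a) by lia.
apply: (@leq_trans (e * e * (16 * n))); first by rewrite leq_mul2l Ha orbT.
have : 16 * (e * e) <= n by lia.
by move=> le; rewrite mulnA [e * e * 16]mulnC leq_mul2r le orbT.
Qed.

Lemma polyb_shift u : polyb u -> exists D E, forall m, u m <= D * m.+1 ^ E.
Proof.
move=> [B HB]; exists (2 ^ B), B => m; apply: leq_trans (HB m) _.
by rewrite -expnMn; apply: expn_base_mono; lia.
Qed.

(** An instance depends on the formula only through [n] and the set of present clause codes, so its
    treewidth is bounded in [n] alone. Its encoding is given by a length and a bit function, as the
    transducer requires. *)
Lemma eth_lower_bound (A : Type) (valid P : A -> Prop) (enc : A -> seq bool)
    (gr : A -> graph) (sz : A -> nat) (inst : nat -> pred nat -> A)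
    (len : nat -> nat) (bit : nat -> pred nat -> nat -> bool) :
  (forall n pr, enc (inst n pr) = mkseq (bit n pr) (len n)) ->
  @comp 0 (fun c => len (nv (inp c))) ->
  @comp 1 (fun c => bit (nv (inp c)) (present (inp c)) c.2 : nat) ->
  (forall n pr, valid (inst n pr)) ->
  (forall n pr, P (inst n pr) <-> coded_sat n pr) ->
  (forall n pr, tw_le (gr (inst n pr)) (nhubs n).+1) ->
  (forall n pr, sz (inst n pr) < size (enc (inst n pr))) ->
  ETH ->
  ~ exists (M : TM) (C c : nat) (g : nat -> nat), little_o g /\
      solves_within M valid P enc (fun a steps => forall tw, is_treewidth (gr a) tw ->
        steps <= C * 2 ^ (2 ^ g tw) * (sz a).+1 ^ c).
Proof.
move=> Henc Hlen Hbit Hvalid HP Htw Hsz eth [M [C [c [g [Hg [Hne HM]]]]]]; apply: eth.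
have [Q [B HQ]] := transducer Hlen Hbit.
have [M' [D [Hne' HM']]] := chain_program Q M.
have [|D1 [E1 HT]] := @polyb_shift (fun m => D * (m + m.+2 ^ B + 2) ^ 2 + C * (m.+2 ^ B) ^ c).
  by auto 20 with polyb.
exists M', D1, E1, (worst g); split; first exact: worst_little_o.
split; first exact: Hne'.
move=> phi _; set x := enc_cnf3 phi; set n := nvars phi.
have nvx : nv x = n := nvE phi.
set a := inst n (present x).
have [Hsy [t1 Ht1 Hex]] := HQ x.
have Ey : mkseq (fun i => bit (nv x) (present x) i) (len (nv x)) = enc a by rewrite nvx /a Henc.
rewrite /= in Hex Hsy; rewrite Ey in Hex Hsy.
have [t0 Ht0 Hrun] := HM' x (enc a) t1 Hex.
have [t2 [Ht2 Hres]] := HM a (Hvalid _ _).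
have [tw [Htw1 Htw2]] := least_nat (Htw n (present x)).
have letw : tw <= (nhubs n).+1 by apply: Htw2; apply: Htw.
have Hans : P a <-> satisfiable3 phi.
  by split=> H; [apply/coded_satP/HP | apply/HP/coded_satP].
exists (t0 + t2); split; last first.
  have [Hacc Hrej] := Hrun t2.
  by case: Hres => [[/Hacc-> /Hans]|[/Hrej-> Hn]]; [left | right; split=> // /Hans].
have {}Ht2 := Ht2 tw (conj Htw1 Htw2).
have Hw : 2 ^ g tw <= worst g n.
  have lt : tw < (nhubs n).+2 by [].
  exact: (leq_bigmax (F := fun w : 'I_(nhubs n).+2 => 2 ^ g w) (Ordinal lt)).
set m := size x in Ht0 Hsy Ht1 *.
have Hsza : (sz a).+1 ^ c <= (m.+2 ^ B) ^ c.
  by apply: expn_base_mono; apply: leq_trans Hsy; apply: Hsz.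
have Hp : 2 ^ (2 ^ g tw) <= 2 ^ worst g n by rewrite leq_exp2l.
have H0 : t0 <= D * (m + m.+2 ^ B + 2) ^ 2.
  apply: leq_trans Ht0 _; rewrite leq_mul2l; apply/orP; right.
  by apply: expn_base_mono; rewrite leq_add2r leq_add2l.
have W0 : 0 < 2 ^ worst g n by rewrite expn_gt0.
rewrite -mulnA [2 ^ _ * _]mulnC mulnA.
apply: leq_trans (_ : (D * (m + m.+2 ^ B + 2) ^ 2 + C * (m.+2 ^ B) ^ c) * 2 ^ worst g n <= _); last first.
  by rewrite leq_mul2r HT orbT.
(* The time of the reduction is absorbed by the positive factor [2 ^ worst g n]. *)
rewrite mulnDl; apply: leq_add; first by apply: leq_trans H0 (leq_pmulr _ _).
apply: leq_trans Ht2 _; rewrite -!mulnA leq_mul2l; apply/orP; right.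
by rewrite [X in _ <= X]mulnC leq_mul.
Qed.

Lemma lds_size_lt n pr : gn (lds_G (lds_of n pr)) < size (enc_lds (lds_of n pr)).
Proof. by rewrite /enc_lds /enc_graph /unary !size_cat size_nseq /=; lia. Qed.

Lemma tc_size_lt n pr :
  tc_nU (tc_of n pr) + tc_nF (tc_of n pr) < size (enc_tc (tc_of n pr)).
Proof. by rewrite /enc_tc /unary !size_cat !size_nseq /=; lia. Qed.

Theorem theorem1 :
  ETH ->
  (~ exists (M : TM) (C c : nat) (g : nat -> nat),
       little_o g /\
       solves_within M (fun I => simple_graph (lds_G I)) lds_yes enc_lds
         (fun I steps => forall tw, is_treewidth (lds_G I) tw ->
            steps <= C * 2 ^ (2 ^ g tw) * (gn (lds_G I)).+1 ^ c)) /\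
  (~ exists (M : TM) (C c : nat) (g : nat -> nat),
       little_o g /\
       solves_within M (fun _ => True) tc_yes enc_tc
         (fun I steps => forall tw, is_treewidth (tc_aux I) tw ->
            steps <= C * 2 ^ (2 ^ g tw) * (tc_nU I + tc_nF I).+1 ^ c)).
Proof.
move=> eth; split.
  apply: (eth_lower_bound (gr := lds_G) (sz := fun I => gn (lds_G I)) enc_lds_mkseq
            comp_lds_len comp_lds_bit) => //.
  - exact: lds_simple.
  - by move=> n pr; split; [apply: lds_sound | apply: lds_complete].
  - exact: lds_tw.
  - exact: lds_size_lt.
apply: (eth_lower_bound (gr := tc_aux) (sz := fun I => tc_nU I + tc_nF I) enc_tc_mkseq
          comp_tc_len comp_tc_bit) => //.
- by move=> n pr; split; [apply: tc_sound | apply: tc_complete].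
- exact: tc_tw.
- exact: tc_size_lt.
Qed.
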